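(* Let $\pi$ be a projective plane of prime order $p$ such that the $p$-ary code $C_p(\pi)$ has the same complete weight enumerator as the $p$-ary code $C_p(PG(2,\mathbb{F}_p))$. If $p>2^9$, then $\pi$ is isomorphic to $PG(2,\mathbb{F}_p)$.
   Context: An incidence system is a pair $(P,L)$ where $P$ is a set (of points) and $L$ is a set of subsets of $P$ (the lines). Two incidence systems $(P,L)$ and $(P',L')$ are isomorphic if there are bijections $f:P\to P'$ and $g:L\to L'$ such that $x\in\ell\Leftrightarrow f(x)\in g(\ell)$ for all $x\in P$, $\ell\in L$. A projective plane is an incidence system such that: each line has at least two points and any two distinct points are together on a unique line; each point is on at least two lines and any two distinct lines have a unique common point; and for any two distinct lines there is a point on neither of them. A finite projective plane has order $n\ge 2$ if each line has exactly $n+1$ points (equivalently each point is on exactly $n+1$ lines). $PG(2,\mathbb{F}_p)$ is the projective plane of order $p$ whose points are the 1-dimensional subspaces of a 3-dimensional vector space $V$ over $\mathbb{F}_p=\mathbb{Z}/p\mathbb{Z}$ and whose lines are the 2-dimensional subspaces of $V$, each identified with the set of 1-dimensional subspaces it contains. For a prime $p$ and a finite set $P$, $\mathbb{F}_p^P$ is the $\mathbb{F}_p$-vector space of functions $P\to\mathbb{F}_p$. The type of $w\in\mathbb{F}_p^P$ is the tuple $(a_\alpha:\alpha\in\mathbb{F}_p)$ with $a_\alpha=\#\{x\in P:w(x)=\alpha\}$. For a finite incidence system $\mathcal{X}=(P,L)$, $C_p(\mathcal{X})$ is the subspace of $\mathbb{F}_p^P$ spanned by the indicator functions of the lines of $\mathcal{X}$.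 For commuting variables $\underline{Z}=(Z_\alpha:\alpha\in\mathbb{F}_p)$, write $\underline{Z}^{\underline{j}}=\prod_\alpha Z_\alpha^{j_\alpha}$. The complete weight enumerator of a subspace $C\subseteq\mathbb{F}_p^P$ is the polynomial $\sum_{w\in C}\underline{Z}^{\mathrm{type}(w)}$. *)

(* Defs.v *)
From HB Require Import structures.
From mathcomp Require Import all_boot all_order all_fingroup all_algebra.
From mathcomp Require Import mpoly.

Set Implicit Arguments.
Unset Strict Implicit.
Unset Printing Implicit Defensive.

Import GRing.Theory.

Local Open Scope ring_scope.

Record incidence_system := IncidenceSystem {
  point : finType;
  lines : {set {set point}}
}.

Definition isomorphic (X Y : incidence_system) : Prop :=
  exists (f : point X -> point Y)
         (g : {l : {set point X} | l \in lines X} ->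
              {l : {set point Y} | l \in lines Y}),
    [/\ bijective f, bijective g &
        forall (x : point X) (l : {l : {set point X} | l \in lines X}),
          x \in val l <-> f x \in val (g l)].

Definition projective_plane (X : incidence_system) : Prop :=
  [/\ (forall l, l \in lines X -> (2 <= #|l|)%N)
      /\ (forall x y : point X, x != y ->
            exists! l, [/\ l \in lines X, x \in l & y \in l]),
      (forall x : point X, (2 <= #|[set l in lines X | x \in l]|)%N)
      /\ (forall l m, l \in lines X -> m \in lines X -> l != m ->
            exists! x : point X, x \in l /\ x \in m)
    & forall l m, l \in lines X -> m \in lines X -> l != m ->
        exists x : point X, x \notin l /\ x \notin m].

Definition has_order (X : incidence_system) (n : nat) : Prop :=
  (2 <= n)%N /\ forall l, l \in lines X -> #|l| = n.+1.

(* The library gives {vspace vT} only a choiceType structure; over a finite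
   field it is a finite type, each subspace being stored as a matrix. *)
Section FiniteSubspaces.
Import VectorInternalTheory.
Variables (F : finFieldType) (vT : vectType F).
HB.instance Definition _ := [Countable of {vspace vT} by <:].
HB.instance Definition _ := [Finite of {vspace vT} by <:].
End FiniteSubspaces.

Section PG2.
Variable F : finFieldType.
Let V := 'rV[F]_3.

Definition PG2_point : finType := {U : {vspace V} | \dim U == 1%N}.

Definition PG2_line (W : {vspace V}) : {set PG2_point} :=
  [set x : PG2_point | (val x <= W)%VS].

Definition PG2 : incidence_system :=
  @IncidenceSystem PG2_point
    [set PG2_line W | W in [set W : {vspace V} | \dim W == 2%N]].
End PG2.

(* 'F_p is F_p only when p is prime. The regular module ('F_p)^o is convertible
   to 'F_p and provides the vector space structure on functions. *)
Notation word p P := {ffun P -> ('F_p)^o}.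

Definition indicator (p : nat) (P : finType) (l : {set P}) : word p P :=
  [ffun x => (x \in l)%:R].

Definition code (p : nat) (X : incidence_system) : {vspace word p (point X)} :=
  <<[seq indicator p l | l <- enum (lines X)]>>%VS.

Definition word_type (p : nat) (P : finType) (w : word p P) :
    {ffun 'F_p -> nat} :=
  [ffun a : 'F_p => #|[set x | w x == a]|].

(* The variable Z_a is 'X_(enum_rank a), via the enumeration of 'F_p. *)
Definition complete_weight_enumerator (p : nat) (P : finType)
    (C : {vspace word p P}) : {mpoly int[#|'F_p|]} :=
  \sum_(w : {ffun P -> 'F_p} | (w : word p P) \in C)
    \prod_(a : 'F_p) 'X_(enum_rank a) ^+ word_type w a.

(* Main.v *)
Require Import Defs.
From mathcomp Require Import all_boot all_order all_algebra.
From mathcomp Require Import perm mpoly zify ring.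

(**
A word of C_p(pi) whose entries, lifted to 0 .. p - 1, have integer sum
t (p + 1) with t < p is a sum of t lines over the integers: every line meets the
lifted word in t modulo p, hence in t + p e(l) with e(l) >= 0, and adding this
over the pencil of a point x gives w(x) = sum of the e(l) with x on l.

Nine lines l_i give the word sum 2^i l_i, of total (2^9 - 1)(p + 1), and the
value at x encodes which of the l_i contain x. A word of the same type in
C_p(PG(2, F_p)) is a sum of lines; counting the points with a given value shows
that it is again of the form sum 2^i l'_i, where the l'_i realise the same
incidence patterns as the l_i. Pappus' theorem involves nine lines, so it holds
in pi because it holds in PG(2, F_p).

Fix three points at infinity x, y, z. By Pappus (Thomsen's closure condition) the
shifts of an affine y-line along z and back along x commute pairwise and act
transitively on p points; hence they are the powers of one p-cycle, which
coordinatises the 3-net by F_p. Pappus applied to two lines of one parallel class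
says that the parallelism of any other direction w is invariant under shifts
along that class, hence under all translations of F_p^2, and so the w-lines are
the level sets of a linear form.
*)

Set Implicit Arguments.
Unset Strict Implicit.
Unset Printing Implicit Defensive.
Import GRing.Theory.
Local Open Scope nat_scope.

(** * Projective planes of order n *)

Section Planes.
Variables (X : incidence_system) (n : nat).
Hypotheses (plX : projective_plane X) (ordX : has_order X n).
Implicit Types (x y : point X) (l m : {set point X}).

Lemma join_exists x y : x != y -> exists2 l, l \in lines X & (x \in l) && (y \in l).
Proof.
case: plX => -[_ H] _ _ /H [l [[ll xl yl] _]].
by exists l => //; rewrite xl.
Qed.

Lemma line_eq x y l m : l \in lines X -> m \in lines X -> x != y ->
  x \in l -> y \in l -> x \in m -> y \in m -> l = m.
Proof.
case: plX => -[_ H] _ _ ll lm /H [k [_ U]] xl yl xm ym.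
by rewrite -(U l) // (U m).
Qed.

Lemma meet_exists l m : l \in lines X -> m \in lines X ->
  exists2 x, x \in l & x \in m.
Proof.
case: plX => -[H2 _] [_ H] _ ll lm; have [<-|nlm] := eqVneq l m.
  have : 0 < #|l| by apply: leq_trans (H2 _ ll).
  by case/card_gt0P=> x xl; exists x.
by have [x [[xl xm] _]] := H l m ll lm nlm; exists x.
Qed.

Lemma point_eq l m x y : l \in lines X -> m \in lines X -> l != m ->
  x \in l -> x \in m -> y \in l -> y \in m -> x = y.
Proof.
move=> ll lm nlm xl xm yl ym; apply/eqP/negPn/negP => nxy.
by case/eqP: nlm; apply: (line_eq ll lm nxy).
Qed.

Lemma card_line l : l \in lines X -> #|l| = n.+1.
Proof. by case: ordX => _; apply. Qed.

Lemma second_point x l : l \in lines X -> exists2 y, y \in l & y != x.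
Proof.
case: plX => -[H2 _] _ _ ll; case/card_gt1P: (H2 _ ll) => y [z [yl zl nyz]].
by have [eyx|] := eqVneq y x; [exists z; rewrite // -eyx eq_sym | exists y].
Qed.

(** Take two lines through [x] and a further point on each: the line joining these two points misses
    [x]. *)
Lemma avoid_exists x : exists2 l, l \in lines X & x \notin l.
Proof.
case: (plX) => _ [H _] _.
case/card_gt1P: (H x) => l [m]; rewrite !inE => -[/andP[ll xl] /andP[lm xm] nlm].
have [y yl nyx] := second_point x ll; have [z zm nzx] := second_point x lm.
have nyz : y != z.
  apply/negP=> /eqP eyz; case/eqP: nyx; apply: (point_eq ll lm) => //.
  by rewrite eyz.
have [k lk /andP[yk zk]] := join_exists nyz.
exists k => //; apply/negP=> xk; case/eqP: nlm.
rewrite -(line_eq lk ll nyx) // -(line_eq lk lm nzx) //.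
Qed.

(** Projection from [x] onto a line missing [x] is a bijection between the pencil and the points of
    that line. *)
Lemma card_pencil x : #|[set l in lines X | x \in l]| = n.+1.
Proof.
have [l ll xl] := avoid_exists x.
(* [f y] is the line joining [x] and [y]; the default [set0] does not arise for [y] on [l], since
   [x] is off [l]. *)
pose f y := odflt set0 [pick m in lines X | (x \in m) && (y \in m)].
have fP y : y \in l -> [/\ f y \in lines X, x \in f y & y \in f y].
  move=> yl; rewrite /f; case: pickP => [m /and3P[] //|H].
  have nxy : x != y by apply: contraNneq xl => ->.
  by have [m lm xym] := join_exists nxy; move: (H m); rewrite lm xym.
rewrite -(card_line ll) -(card_in_imset (f := f) (D := l)); last first.
  move=> y z yl zl efyz; have [ly xy yy] := fP _ yl; have [_ _ zz] := fP _ zl.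
  by rewrite -efyz in zz; apply: (point_eq ly ll) => //; apply: contraNneq xl => <-.
apply/eq_card=> m; rewrite !inE; apply/andP/imsetP => [[lm xm]|[y yl ->]]; last first.
  by have [] := fP _ yl.
have [y ym yl] := meet_exists lm ll; exists y => //.
have [ly xy yy] := fP _ yl; apply: (line_eq lm ly (x := x) (y := y)) => //.
by apply: contraNneq xl => ->.
Qed.

(* Each point other than x is on exactly one of the n + 1 lines through x. *)
Lemma sum_pencil (w : point X -> nat) x :
  \sum_(l in lines X | x \in l) \sum_(y in l) w y = \sum_y w y + n * w x.
Proof.
transitivity (\sum_y \sum_(l in lines X | (x \in l) && (y \in l)) w y).
  rewrite (exchange_big_dep predT) //=.
  by apply: eq_bigr => y _; apply: eq_bigl => l; rewrite andbA.
rewrite (bigD1 x) //= [X in _ = X + _](bigD1 x) //=.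
rewrite sum_nat_const (_ : #|_| = n.+1); last first.
  rewrite -(card_pencil x); apply: eq_card => l; rewrite !inE.
  by rewrite unfold_in /= andbb.
rewrite (eq_bigr w); first by rewrite mulSn addnAC.
move=> y nyx; have nxy : x != y by rewrite eq_sym.
have [k lk /andP[xk yk]] := join_exists nxy.
rewrite (big_pred1 k) // => l; apply/and3P/eqP => [[ll xl yl]|->//].
exact: (line_eq ll lk nxy).
Qed.

End Planes.

(** * Nonnegative combinations of lines *)

Lemma exists_of_card_lt (T : finType) (A B : {pred T}) :
  #|A| < #|B| -> exists2 x, x \in B & x \notin A.
Proof.
move=> lt; have: ~~ (B \subset A).
  by apply: contraL lt => sBA; rewrite -leqNgt subset_leq_card.
by case/subsetPn=> x xB xA; exists x.
Qed.

(** Uniqueness of binary digits: parity gives the lowest digit, and halving leaves the remaining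
    ones. *)
Lemma bits_inj k (b c : 'I_k -> bool) :
  \sum_(i < k | b i) 2 ^ i = \sum_(i < k | c i) 2 ^ i -> b =1 c.
Proof.
elim: k b c => [|k IHk] b c E i; first by case: i.
have step (d : 'I_k.+1 -> bool) :
    \sum_(i < k.+1 | d i) 2 ^ i
    = d ord0 + (\sum_(i < k | d (lift ord0 i)) 2 ^ i).*2.
  rewrite big_mkcond big_ord_recl -mul2n big_distrr /=; congr (_ + _).
  rewrite [in RHS]big_mkcond; apply: eq_bigr => j _.
  by rewrite /bump add1n expnS.
move: E; rewrite !step => E.
have E0 : b ord0 = c ord0.
  by have := congr1 odd E; rewrite !oddD !odd_double !oddb !addbF.
have /IHk Es : \sum_(i < k | b (lift ord0 i)) 2 ^ i
             = \sum_(i < k | c (lift ord0 i)) 2 ^ i.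
  by apply: double_inj; apply: (@addnI (b ord0)); rewrite {2}E0.
by case: (unliftP ord0 i) => [j ->|->].
Qed.

Lemma sum_bits_lt k (b : 'I_k -> bool) : \sum_(i < k | b i) 2 ^ i < 2 ^ k.
Proof.
apply: (@leq_ltn_trans (\sum_(i < k) 2 ^ i)).
  by rewrite big_mkcond; apply: leq_sum => i _; case: ifP.
elim: k {b} => [|k IHk]; first by rewrite big_ord0.
by rewrite big_ord_recr /= expnS mul2n -addnn -addSn leq_add2r.
Qed.

Section LineMultiplicities.
Variables (X : incidence_system) (n : nat).
Hypotheses (plX : projective_plane X) (ordX : has_order X n).
Implicit Types (x y : point X) (l m : {set point X}) (A : {set {set point X}}).
Implicit Types (e : {set point X} -> nat).

Definition mult e x := \sum_(l in lines X | x \in l) e l.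

Definition supp e := [set l in lines X | 0 < e l].

(* The excess of w on a line over t is a multiple e(l) of n, and adding up over
   the pencil at x shows that these e(l) are the coefficients. *)
Lemma line_decomposition (w : point X -> nat) t : t < n ->
  \sum_x w x = t * n.+1 ->
  (forall l, l \in lines X -> \sum_(x in l) w x = t %[mod n]) ->
  exists e, forall x, w x = mult e x.
Proof.
move=> ltn tot H; pose s l := \sum_(x in l) w x.
have sE l : l \in lines X -> s l = n * (s l %/ n) + t.
  by move=> ll; rewrite {1}(divn_eq (s l) n) (H _ ll) modn_small // mulnC.
exists (fun l => s l %/ n) => x; apply/eqP.
have n_gt0 : 0 < n by apply: leq_ltn_trans ltn.
rewrite -(eqn_pmul2l n_gt0) -(eqn_add2l (t * n.+1)) -{1}tot.
rewrite -(sum_pencil plX ordX) big_distrr /=.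
rewrite (eq_bigr (fun l => n * (s l %/ n) + t)); last by move=> l /andP[/sE].
rewrite big_split /= addnC sum_nat_const; apply/eqP; congr (_ + _).
rewrite mulnC; congr (_ * _); rewrite -(card_pencil plX ordX x).
by apply: eq_card => l; rewrite !inE.
Qed.

Lemma sum_mult e : \sum_x mult e x = n.+1 * \sum_(l in lines X) e l.
Proof.
rewrite /mult (exchange_big_dep (mem (lines X))) /=; last by move=> x l _ /andP[].
rewrite big_distrr /=; apply: eq_bigr => l ll.
rewrite (eq_bigl (mem l)); last by move=> x /=; rewrite ll.
by rewrite sum_nat_const (card_line ordX).
Qed.

(** When [A] is the support of [e], these are the points of [l] at which the combination takes the
    bare coefficient [e l]. *)
Definition private A l := [set x in l | [forall m in A, (x \in m) ==> (m == l)]].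

Definition meeting A := [set x | [exists l in A, exists m in A,
  [&& l != m, x \in l & x \in m]]].

(** Each of the other #|A| - 1 lines of [A] removes at most one of the n + 1 points of [l]. *)
Lemma card_private A l : A \subset lines X -> l \in A ->
  n.+2 <= #|private A l| + #|A|.
Proof.
move=> sA lA; have ll := subsetP sA _ lA.
have [x0 x0l] : exists x0, x0 \in l by apply/card_gt0P; rewrite (card_line ordX).
pose f m := odflt x0 [pick y in l :&: m].
have sub : l :\: private A l \subset f @: (A :\ l).
  apply/subsetP=> x; rewrite !inE negb_and => /andP[+ xl]; rewrite xl /=.
  case/forallPn=> m; rewrite !negb_imply => /and3P[mA xm nml].
  apply/imsetP; exists m; rewrite ?inE ?nml // /f.
  case: pickP => [y /=|/(_ x)]; rewrite inE ?xl ?xm //= => /andP[yl ym].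
  have lm := subsetP sA _ mA.
  by apply: (point_eq plX ll lm) => //; rewrite eq_sym.
have := leq_trans (subset_leq_card sub) (leq_imset_card _ _).
have := cardsID (private A l) l; rewrite (card_line ordX ll); have := cardsD1 l A; rewrite lA.
rewrite (setIidPr _); last by apply/subsetP=> x; rewrite inE => /andP[].
by move=> -> <-; rewrite add1n addnS ltnS leq_add2l.
Qed.

(** Such a point is determined by an ordered pair of distinct lines of [A] through it. *)
Lemma card_meeting A : A \subset lines X -> #|meeting A| <= #|A| * #|A|.
Proof.
move=> sA; have [->|[x0 _]] := set_0Vmem (meeting A); first by rewrite cards0.
pose f (lm : {set point X} * {set point X}) := odflt x0 [pick y in lm.1 :&: lm.2].
rewrite -cardsX; apply: leq_trans (leq_imset_card f _).
apply/subset_leq_card/subsetP=> x; rewrite inE.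
case/existsP=> l /andP[lA /existsP[m /and4P[mA nlm xl xm]]].
apply/imsetP; exists (l, m); rewrite ?inE ?lA // /f /=.
case: pickP => [y /=|/(_ x)]; rewrite inE ?xl ?xm //= => /andP[yl ym].
exact: (point_eq plX (subsetP sA _ lA) (subsetP sA _ mA)).
Qed.

Lemma mult_gt0 e x : (0 < mult e x) = [exists l in supp e, x \in l].
Proof.
rewrite lt0n sum_nat_eq0 negb_forall; apply: eq_existsb => l.
by rewrite negb_imply -lt0n inE -!andbA; do !bool_congr.
Qed.

Lemma mult_private e l x : l \in supp e -> x \in private (supp e) l ->
  mult e x = e l.
Proof.
move=> lA; rewrite inE => /andP[xl /forallP H].
have ll : l \in lines X by move: lA; rewrite inE => /andP[].
rewrite /mult (bigD1 l) ?ll //= big1 ?addn0 // => m /andP[/andP[lm xm] nml].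
apply/eqP; rewrite -leqn0 leqNgt; apply: contra nml => em.
by move: (H m); rewrite inE lm em xm.
Qed.

Lemma mult_meeting e x : 0 < mult e x -> x \notin meeting (supp e) ->
  exists2 l, l \in supp e & mult e x = e l.
Proof.
rewrite mult_gt0 => /existsP[l /andP[lA xl]] xM; exists l => //.
apply: mult_private => //; rewrite inE xl; apply/forall_inP => m mA.
apply/implyP=> xm; apply: contraR xM => nml; rewrite inE.
by apply/exists_inP; exists m => //; apply/exists_inP; exists l => //; rewrite nml xm.
Qed.

Lemma supp_sub e : supp e \subset lines X.
Proof. by apply/subsetP=> l; rewrite inE => /andP[]. Qed.

Lemma card_mult_gt0 e : #|[set x | 0 < mult e x]| <= #|supp e| * n.+1.
Proof.
have sub : [set x | 0 < mult e x] \subset \bigcup_(l in supp e) l.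
  apply/subsetP=> x; rewrite inE mult_gt0 => /exists_inP[l lA xl].
  by apply/bigcupP; exists l.
apply: leq_trans (subset_leq_card sub) _.
apply: (@leq_trans (\sum_(l in supp e) #|l|)).
  elim/big_rec2: _ => [|l s B _ IH]; first by rewrite cards0.
  by apply: leq_trans (leq_card_setU _ _) _; rewrite leq_add2l.
rewrite -sum_nat_const leq_eqVlt; apply/orP; left; apply/eqP.
by apply: eq_bigr => l /(subsetP (supp_sub e)); apply: card_line.
Qed.

(** The sets [private B l] are pairwise disjoint, and each lies in a line of the support. *)
Lemma card_mult_gt0_lower e (B : {set {set point X}}) : B \subset supp e ->
  \sum_(l in B) #|private B l| <= #|[set x | 0 < mult e x]|.
Proof.
move=> sB; rewrite -sum1_card.
under eq_bigr do rewrite -sum1_card big_mkcond.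
rewrite exchange_big /= [leqRHS]big_mkcond; apply: leq_sum => x _.
rewrite -big_mkcondr; case: (pickP [pred l in B | x \in private B l]) => [l /=|H].
  case/andP=> lB xl; rewrite inE mult_gt0.
  have xil : x \in l by move: xl; rewrite inE => /andP[].
  have -> : [exists l in supp e, x \in l].
    by apply/exists_inP; exists l; rewrite // (subsetP sB).
  rewrite (big_pred1 l) // => m; apply/andP/eqP => [[mB xm]|->//].
  move: xm; rewrite inE => /andP[_ /forall_inP/(_ l lB)].
  by rewrite xil => /eqP.
by rewrite big_pred0 // => l; apply: H.
Qed.

End LineMultiplicities.

(** * Combinations of lines with the same distribution of values *)

Section Comparison.
Variables (X Y : incidence_system) (n k : nat).
Hypotheses (plX : projective_plane X) (ordX : has_order X n).
Hypotheses (plY : projective_plane Y) (ordY : has_order Y n).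
Hypothesis (small : k * k.+1 <= n).
Variables (e : {set point X} -> nat) (f : {set point Y} -> nat).
Hypothesis (cardXY : #|point X| = #|point Y|).
Hypothesis (same : forall c,
  #|[set x | mult e x == c]| = #|[set y | mult f y == c]|).

(** With s = #|supp e|, both combinations are nonzero on the same number of points, at most s(n +
    1). But s + 1 lines of [supp f] would have at least (s + 1)(n + 1 - s) private points, which is
    more because s(s + 1) <= n. *)
Lemma card_supp_le : #|supp e| <= k -> #|supp f| <= #|supp e|.
Proof.
move=> le_ek; rewrite leqNgt; apply/negP=> lt_ef.
have [B /andP[sB /eqP cB]] : exists B : {set {set point Y}},
    (B \subset supp f) && (#|B| == #|supp e|.+1).
  pose s := take #|supp e|.+1 (enum (supp f)).
  have us : uniq s by rewrite take_uniq ?enum_uniq.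
  exists [set l in s]; apply/andP; split.
    by apply/subsetP=> l; rewrite inE => /mem_take; rewrite mem_enum.
  by rewrite cardsE (card_uniqP us) size_takel // -cardE.
have sBl := subset_trans sB (supp_sub f).
have := card_mult_gt0_lower sB.
have -> : #|[set y | 0 < mult f y]| = #|[set x | 0 < mult e x]|.
  have compl (Z : incidence_system) (g : {set point Z} -> nat) :
      [set z | 0 < mult g z] = ~: [set z | mult g z == 0].
    by apply/setP=> z; rewrite !inE lt0n.
  by rewrite !compl [LHS]cardsCs [RHS]cardsCs !setCK same -cardXY.
have := card_mult_gt0 ordX e.
have : #|B| * (n.+2 - #|B|) <= \sum_(l in B) #|private B l|.
  rewrite -sum_nat_const; apply: leq_sum => l lB.
  by have := card_private plY ordY sBl lB; lia.
rewrite cB; move: #|supp e| le_ek => s le_sk; nia.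
Qed.

(** The value [e l] is taken at the private points of [l], of which there are at least n + 2 - k,
    more than the at most k^2 points on two lines of [supp f]. So [mult f] takes this value at a
    point on a single line of [supp f], whose coefficient it is. *)
Lemma supp_value_transfer : #|supp e| <= k -> #|supp f| <= k ->
  forall l, l \in supp e -> exists2 m, m \in supp f & f m = e l.
Proof.
move=> le_ek le_fk l lA.
have el : 0 < e l by move: lA; rewrite inE => /andP[].
have [|y] := @exists_of_card_lt _ (meeting (supp f)) [set y | mult f y == e l].
  apply: leq_ltn_trans (card_meeting plY (supp_sub f)) _.
  rewrite -same; apply: (@leq_trans #|private (supp e) l|).
    have := card_private plX ordX (supp_sub e) lA.
    by move: #|supp e| #|supp f| le_ek le_fk => a b; nia.
  by apply/subset_leq_card/subsetP=> x /(mult_private lA) ex; rewrite inE ex.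
rewrite inE => /eqP fy /mult_meeting []; first by rewrite fy.
by move=> m mA; rewrite fy => ->; exists m.
Qed.

End Comparison.

(** * Words of the code *)

Section CompleteWeightEnumerator.
Variables (p : nat) (P : finType) (C : {vspace word p P}).
Local Open Scope ring_scope.

Definition type_mnm (w : word p P) : 'X_{1.. #|'F_p|} :=
  [multinom word_type w (enum_val i) | i < #|'F_p|].

Lemma cwe_coef (m : 'X_{1.. #|'F_p|}) :
  (complete_weight_enumerator C)@_m
  = #|[set w : word p P | (w \in C) && (type_mnm w == m)]|%:R.
Proof.
set S := [set w | _]; rewrite -(sum1_card (mem S)) natr_sum {}/S.
rewrite /complete_weight_enumerator raddf_sum /=.
rewrite [RHS](eq_bigl (fun w : word p P => (w \in C) && (type_mnm w == m)));
  last by move=> w; rewrite inE.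
rewrite big_mkcondr /=; apply: eq_bigr => w _.
have -> : \prod_(a : 'F_p) 'X_(enum_rank a) ^+ word_type w a
        = 'X_[type_mnm w] :> {mpoly int[#|'F_p|]}.
  rewrite (mpolyXE _ 1%g) (reindex enum_rank) /=; last first.
    by apply: onW_bij; apply: enum_rank_bij.
  by apply: eq_bigr => a _; rewrite perm1 mnmE enum_rankK.
by rewrite mcoeffX; case: eqP.
Qed.

End CompleteWeightEnumerator.

(** The coefficient of a monomial counts the words of that type, and it is positive for the type of
    [v]. *)
Lemma cwe_types p (P Q : finType) (C : {vspace word p P}) (D : {vspace word p Q}) :
  complete_weight_enumerator C = complete_weight_enumerator D ->
  forall v : word p P, v \in C ->
  exists2 w : word p Q, w \in D & word_type w = word_type v.
Proof.
move=> E v vC; pose m := type_mnm v.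
have: (0 < #|[set w : word p P | (w \in C) && (type_mnm w == m)]|)%N.
  by apply/card_gt0P; exists v; rewrite inE vC /m eqxx.
have /eqP := congr1 (mcoeff m) E; rewrite !cwe_coef Num.Theory.eqr_nat => /eqP ->.
case/card_gt0P=> w; rewrite inE => /andP[wD /eqP ewv]; exists w => //.
apply/ffunP=> a; move/mnmP/(_ (enum_rank a)): ewv.
by rewrite /m !mnmE enum_rankK.
Qed.

(** Such sums depend on the type only; this yields the number of points, the total of the lifted
    entries and the number of points with a given value. *)
Lemma sum_word_type p (P : finType) (w : word p P) (g : 'F_p -> nat) :
  \sum_x g (w x) = \sum_a word_type w a * g a.
Proof.
rewrite (partition_big (w : P -> 'F_p) predT) //=; apply: eq_bigr => a _.
rewrite (eq_bigr (fun=> g a)); last by move=> x /eqP ->.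
rewrite sum_nat_const ffunE; congr (_ * _).
by apply: eq_card => x; rewrite !inE.
Qed.

(** * Line sums of code words, and lines with binary weights *)

Section LineWords.
Variables (p : nat) (X : incidence_system).
Hypotheses (p_pr : prime p) (plX : projective_plane X) (ordX : has_order X p).

Lemma natr_Fp_eq m1 m2 :
  ((m1%:R : 'F_p) = m2%:R)%R -> m1 = m2 %[mod p].
Proof. by move/(congr1 val); rewrite /= !val_Fp_nat. Qed.

Lemma natr_val_Fp (a : 'F_p) : ((val a)%:R = a)%R.
Proof. exact: natr_Zp. Qed.

Lemma natr_Fp_p1 : ((p.+1%:R : 'F_p) = 1)%R.
Proof. by rewrite -natr1 pchar_Fp_0 // add0r. Qed.

(** By linearity it suffices to take for [w] the indicator of a line [m]: then the sums are #|l :&: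
    m|, which is 1 or p + 1, and #|m| = p + 1, all equal to 1 modulo p. *)
Lemma code_sum_line w l : w \in code p X -> l \in lines X ->
  (\sum_(x in l) (w x : 'F_p) = \sum_x (w x : 'F_p))%R.
Proof.
move=> wC ll; pose T := in_tuple [seq indicator p l | l <- enum (lines X)].
have expand (S : {set point X}) : (\sum_(x in S) (w x : 'F_p)
    = \sum_i (coord T i w : 'F_p) * \sum_(x in S) (T`_i x : 'F_p))%R.
  rewrite {1}(coord_span (wC : w \in <<T>>%VS)).
  under eq_bigr do rewrite sum_ffunE.
  rewrite exchange_big /=; apply: eq_bigr => i _; rewrite big_distrr /=.
  by apply: eq_bigr => x _; rewrite ffunE.
have -> : (\sum_x (w x : 'F_p) = \sum_(x in [set: point X]) (w x : 'F_p))%R.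
  by apply: eq_bigl => x; rewrite inE.
rewrite !expand; apply: eq_bigr => i _; congr (_ * _)%R.
have /mapP[m] : (T`_i)%R \in T by rewrite mem_nth // size_tuple.
rewrite mem_enum => lm ->.
have sum_indicator (S : {set point X}) :
    (\sum_(x in S) (indicator p m x : 'F_p) = #|S :&: m|%:R)%R.
  rewrite -sum1_card natr_sum big_mkcond [RHS]big_mkcond /=.
  by apply: eq_bigr => x _; rewrite ffunE inE; case: (x \in S); case: (x \in m).
rewrite !sum_indicator setTI (card_line ordX lm) natr_Fp_p1.
have [<-|nlm] := eqVneq l m; first by rewrite setIid (card_line ordX ll) natr_Fp_p1.
have [x xl xm] := meet_exists plX ll lm.
rewrite (_ : l :&: m = [set x]) ?cards1 //; apply/setP=> y; rewrite !inE.
apply/andP/eqP => [[yl ym]|->//].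
exact: (point_eq plX ll lm nlm).
Qed.

(** The integer sum stays below 2^k <= p, so nothing is lost modulo p. *)
Lemma val_word_sum k (L : 'I_k -> {set point X}) x : 2 ^ k <= p ->
  (\sum_(i < k) (2 ^ i)%N%:R *: indicator p (L i) : word p (point X))%R x
  = \sum_(i < k | x \in L i) 2 ^ i :> nat.
Proof.
move=> lekp; have lt := leq_trans (sum_bits_lt (fun i => x \in L i)) lekp.
rewrite -[RHS](modn_small lt) -val_Fp_nat //; congr val.
rewrite sum_ffunE natr_sum [RHS]big_mkcond /=; apply: eq_bigr => i _.
by rewrite !ffunE; case: (x \in L i); rewrite /= ?scaler0 // /GRing.scale /= mulr1.
Qed.

(** The family may repeat lines: the coefficient of a line collects the weights of all its
    indices. *)
Lemma mult_weights k (L : 'I_k -> {set point X}) x : (forall i, L i \in lines X) ->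
  mult (fun l => \sum_(i < k | L i == l) 2 ^ i) x = \sum_(i < k | x \in L i) 2 ^ i.
Proof.
move=> lL; rewrite /mult (exchange_big_dep (fun i => x \in L i)) /=; last first.
  by move=> l i /andP[_ xl] /eqP ->.
apply: eq_bigr => i xLi; rewrite (big_pred1 (L i)) // => l.
by rewrite /= eq_sym andbC; case: eqP => // ->; rewrite lL xLi.
Qed.

End LineWords.

(** The word with weights 2^i has as its value at a point the binary code of the incidence pattern
    there. A word of the same type is shown to be a combination of lines with the same
    coefficients. *)
Lemma line_patterns_transfer p (X Y : incidence_system) k
    (L : 'I_k -> {set point X}) :
  prime p ->
  projective_plane X -> has_order X p ->
  projective_plane Y -> has_order Y p ->
  (forall w : word p (point X), w \in code p X ->
     exists2 v : word p (point Y), v \in code p Y & word_type v = word_type w) ->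
  2 ^ k <= p -> k * k.+1 <= p ->
  (forall i, L i \in lines X) ->
  exists M : 'I_k -> {set point Y},
    [/\ forall i, M i \in lines Y,
        forall x, exists y, forall i, (y \in M i) = (x \in L i)
      & forall y, exists x, forall i, (y \in M i) = (x \in L i)].
Proof.
move=> p_pr plX ordX plY ordY types lekp small lL.
pose w : word p (point X) := (\sum_(i < k) (2 ^ i)%N%:R *: indicator p (L i))%R.
have [|v vC tvw] := types w.
  apply: memv_suml => i _; apply/memvZ/memv_span/map_f.
  by rewrite mem_enum.
pose e l := \sum_(i < k | L i == l) 2 ^ i.
have eE x : mult e x = \sum_(i < k | x \in L i) 2 ^ i by apply: mult_weights.
have wE x : mult e x = (w x : 'F_p) by rewrite eE val_word_sum.
have sumE (g : 'F_p -> nat) : \sum_y g (v y) = \sum_x g (w x).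
  by rewrite !sum_word_type tvw.
pose t := \sum_(i < k) 2 ^ i.
have lttp : t < p by apply: leq_trans (sum_bits_lt (fun=> true)) _.
have tot : \sum_y (v y : 'F_p) = t * p.+1.
  rewrite (sumE (fun a => a)); under eq_bigr do rewrite -wE.
  rewrite (sum_mult ordX) mulnC; congr (_ * _).
  rewrite (exchange_big_dep predT) //=; apply: eq_bigr => i _.
  rewrite (big_pred1 (L i)) // => l; rewrite /= [RHS]eq_sym.
  by case: eqP => [<-|_]; rewrite ?lL ?andbF.
have [|f fE] := @line_decomposition Y p plY ordY (fun y => v y : 'F_p) t lttp tot.
  (* Modulo p, a line sum of [v] equals its total t(p + 1), that is, t. *)
  move=> l ll; apply: (natr_Fp_eq p_pr); rewrite natr_sum.
  under eq_bigr do rewrite natr_val_Fp.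
  rewrite (code_sum_line p_pr plY ordY vC ll).
  rewrite (eq_bigr (fun y => (v y : 'F_p)%:R)%R); last first.
    by move=> y _; rewrite natr_val_Fp.
  by rewrite -natr_sum tot natrM natr_Fp_p1 // mulr1.
have cardXY : #|point X| = #|point Y|.
  by have := sumE (fun=> 1); rewrite !sum1_card.
have same c : #|[set x | mult e x == c]| = #|[set y | mult f y == c]|.
  have cnt (Z : finType) (g : Z -> nat) : #|[set z | g z == c]| = \sum_z (g z == c).
    by rewrite -sum1_card big_mkcond; apply: eq_bigr => z _; rewrite inE; case: eqP.
  rewrite !cnt; have := sumE (fun a => (a == c :> nat)) => /esym.
  under eq_bigr do rewrite -wE; move=> ->.
  by under eq_bigr do rewrite fE.
have supp_e : supp e \subset [set L i | i : 'I_k].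
  apply/subsetP=> l; rewrite inE => /andP[_ el]; apply/imsetP.
  case: (pickP (fun i => L i == l)) => [i /eqP <-|H]; first by exists i.
  by move: el; rewrite /e big_pred0.
have le_e : #|supp e| <= k.
  apply: leq_trans (subset_leq_card supp_e) _.
  by apply: leq_trans (leq_imset_card _ _) _; rewrite card_ord.
have le_fe := card_supp_le ordX plY ordY small cardXY same le_e.
have le_f := leq_trans le_fe le_e.
have toY := supp_value_transfer plX ordX plY small cardXY same le_e le_f.
have toX := supp_value_transfer plY ordY plX small (esym cardXY) (fun c => esym (same c)) le_f le_e.
(* The binary digits of [e l] mark the indices at which [l] occurs, and there is one for [l] in the
   support. *)
have e_inj : {in supp e &, injective e}.
  move=> l m lA _ /bits_inj eb; have /imsetP[i _ eli] := subsetP supp_e _ lA.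
  by have := eb i; rewrite eli eqxx eq_sym => /esym/eqP.
(* [g m] is the line of [supp e] with the coefficient of [m]. It is onto because every coefficient
   of [e] occurs in [f]; as [supp f] is not larger than [supp e], [g] is injective, and so is
   [f]. *)
pose g m := odflt set0 [pick l in supp e | e l == f m].
have gP m : m \in supp f -> g m \in supp e /\ e (g m) = f m.
  case/toX=> l lA elm; rewrite /g; case: pickP => [l' /andP[? /eqP]|/(_ l)] //.
  by rewrite /= lA elm eqxx.
have g_inj : {in supp f &, injective g}.
  apply/imset_injP; rewrite eqn_leq leq_imset_card (leq_trans le_fe) //.
  apply/subset_leq_card/subsetP=> l lA; have [m mB fm] := toY l lA.
  have [gA eg] := gP _ mB; apply/imsetP; exists m => //.
  by apply: e_inj; rewrite // eg.
have f_inj : {in supp f &, injective f}.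
  move=> m m' mB mB' fmm'; have [gA eg] := gP _ mB; have [gA' eg'] := gP _ mB'.
  by apply: g_inj => //; apply: e_inj; rewrite // eg eg'.
have suppL i : L i \in supp e.
  by rewrite inE lL /e (bigD1 i) //= addn_gt0 expn_gt0.
have /fin_all_exists[M MP] i : exists m, m \in supp f /\ f m = e (L i).
  by have [m mB fm] := toY _ (suppL i); exists m.
have lM i : M i \in lines Y.
  by have [+ _] := MP i; rewrite inE => /andP[].
(* For [m] in the support, [M i] is [m] exactly when [L i] is the line of [supp e] with the
   coefficient of [m]. *)
have fM m : m \in lines Y -> f m = \sum_(i < k | M i == m) 2 ^ i.
  move=> lm; have [mB|] := boolP (m \in supp f); last first.
    rewrite inE lm -leqNgt leqn0 => /eqP fm0; rewrite big_pred0 ?fm0 // => i.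
    apply/eqP=> eMi; have [] := MP i.
    by rewrite eMi inE lm fm0.
  have [l lA elm] := toX _ mB; rewrite -elm.
  apply: eq_bigl => i; have [MiB fMi] := MP i; apply/eqP/eqP => [eLi|eMi].
    by apply: f_inj; rewrite // fMi eLi.
  by apply: e_inj; rewrite // elm -eMi fMi.
have fE' y : mult f y = \sum_(i < k | y \in M i) 2 ^ i.
  rewrite -(mult_weights _ lM); apply: eq_bigr => m /andP[lm _].
  exact: fM.
(* Equal counts make the same values occur in both planes, and a value determines its incidence
   pattern. *)
have realise (c : nat) x : mult e x = c -> exists y, mult f y = c.
  move=> ex; have : 0 < #|[set y | mult f y == c]|.
    by rewrite -same; apply/card_gt0P; exists x; rewrite inE ex.
  by case/card_gt0P=> y; rewrite inE => /eqP; exists y.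
have realise' (c : nat) y : mult f y = c -> exists x, mult e x = c.
  move=> fy; have : 0 < #|[set x | mult e x == c]|.
    by rewrite same; apply/card_gt0P; exists y; rewrite inE fy.
  by case/card_gt0P=> x; rewrite inE => /eqP; exists x.
exists M; split=> // [x|y].
  have [y] := realise _ x erefl; rewrite fE' eE => /bits_inj H.
  by exists y.
have [x] := realise' _ y erefl; rewrite fE' eE => /bits_inj H.
by exists x.
Qed.

(** * PG(2, F) *)

(* Pappus' theorem with a_ij the line A_i B_j and C_k the common point of a_ij, a_ji
   and n; the conclusion is the last of the 27 incidences. *)
Definition pappian (X : incidence_system) : Prop :=
  forall (l m n a12 a21 a13 a31 a23 a32 : {set point X})
         (A1 A2 A3 B1 B2 B3 C1 C2 : point X),
    all (mem (lines X)) [:: l; m; n; a12; a21; a13; a31; a23; a32] ->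
    [&& A1 \in l, A2 \in l & A3 \in l] ->
    [&& B1 \in m, B2 \in m & B3 \in m] ->
    [&& A1 \in a12, A1 \in a13, A2 \in a21, A2 \in a23, A3 \in a31 & A3 \in a32] ->
    [&& B1 \in a21, B1 \in a31, B2 \in a12, B2 \in a32, B3 \in a13 & B3 \in a23] ->
    [&& C1 \in n, C1 \in a23 & C1 \in a32] ->
    [&& C2 \in n, C2 \in a13 & C2 \in a31] ->
    [&& A1 \notin m, A2 \notin m & A3 \notin m] ->
    [&& B1 \notin l, B2 \notin l & B3 \notin l] ->
    uniq [:: A1; A2; A3] -> uniq [:: B1; B2; B3] ->
  exists C3, [&& C3 \in n, C3 \in a12 & C3 \in a21].

Section PG2Plane.
Variable F : finFieldType.
Local Open Scope ring_scope.
Let V := 'rV[F]_3.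
Implicit Types (u v w : V) (U W : {vspace V}) (x y : PG2_point F).

Lemma dim_full : \dim (fullv : {vspace V}) = 3%N.
Proof. by rewrite dimvf /dim /=. Qed.

Lemma PG2_point_vector x : exists2 v : V, v != 0 & val x = <[v]>%VS.
Proof.
have dx : \dim (val x) = 1%N := eqP (valP x).
have vx := memv_pick (val x); exists (vpick (val x)).
  by rewrite vpick0 -dimv_eq0 dx.
apply/esym/eqP; rewrite eqEdim -memvE vx dx dim_vline vpick0 -dimv_eq0 dx //.
Qed.

Lemma PG2_pointP v : v != 0 -> exists x : PG2_point F, val x = <[v]>%VS.
Proof.
move=> nzv; have d : \dim <[v]> == 1%N by rewrite dim_vline nzv.
by exists (exist _ <[v]>%VS d).
Qed.

Lemma PG2_lineP (l : {set PG2_point F}) :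
  reflect (exists2 W : {vspace V}, \dim W = 2%N & l = PG2_line W)
          (l \in lines (PG2 F)).
Proof.
apply: (iffP imsetP) => -[W]; first by rewrite inE => /eqP dW ->; exists W.
by move=> dW ->; exists W; rewrite ?inE ?dW.
Qed.

Lemma mem_PG2_line x v W : val x = <[v]>%VS -> (x \in PG2_line W) = (v \in W).
Proof. by move=> xv; rewrite inE xv -memvE. Qed.

Lemma exists_notin W : (\dim W < 3)%N -> exists v : V, v \notin W.
Proof.
move=> dW; have : ~~ (fullv <= W)%VS.
  by apply: contraL dW => /dimvS; rewrite dim_full -leqNgt.
by case/subvPn=> v _; exists v.
Qed.

Lemma dim_add_vline U v : v \notin U -> \dim (U + <[v]>) = (\dim U).+1.
Proof.
move=> vU; have nzv : v != 0 by apply: contraNneq vU => ->; rewrite mem0v.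
rewrite dimv_disjoint_sum ?dim_vline ?nzv ?addn1 //.
apply/eqP; rewrite -subv0; apply/subvP=> w /memv_capP[wU /vlineP[k ew]].
have [k0|nzk] := eqVneq k 0; first by rewrite ew k0 scale0r mem0v.
by case/negP: vU; rewrite -[v](scalerK nzk) -ew memvZ.
Qed.

Lemma dim_plane v w : v != 0 -> w \notin <[v]>%VS -> \dim (<[v]> + <[w]>) = 2%N.
Proof. by move=> nzv wv; rewrite dim_add_vline // dim_vline nzv. Qed.

Lemma planeE W v w : \dim W = 2%N -> v \in W -> w \in W -> v != 0 ->
  w \notin <[v]>%VS -> (<[v]> + <[w]>)%VS = W.
Proof.
move=> dW vW wW nzv wv; apply/eqP; rewrite eqEdim subv_add -!memvE vW wW.
by rewrite dW dim_plane.
Qed.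

Lemma plane_comb W v w u : \dim W = 2%N -> v \in W -> w \in W -> v != 0 ->
  w \notin <[v]>%VS -> u \in W -> exists r s, u = r *: v + s *: w.
Proof.
move=> dW vW wW nzv wv; rewrite -(planeE dW vW wW nzv wv).
by case/memv_addP=> a /vlineP[r ->] [b /vlineP[s ->] ->]; exists r, s.
Qed.

Lemma PG2_point_neq x y v w : val x = <[v]>%VS -> val y = <[w]>%VS -> w != 0 ->
  (x != y) = (w \notin <[v]>%VS).
Proof.
move=> xv yw nzw; congr (~~ _); rewrite -val_eqE xv yw.
apply/eqP/idP => [->|wv]; first exact: memv_line.
apply/esym/eqP; rewrite eqEdim -memvE wv !dim_vline nzw.
by case: (v != 0).
Qed.

(** The sum of two distinct planes is the whole space, so the dimension formula gives 2 + 2 - 3. *)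
Lemma dim_cap_lines W1 W2 : \dim W1 = 2%N -> \dim W2 = 2%N -> W1 != W2 ->
  \dim (W1 :&: W2) = 1%N.
Proof.
move=> d1 d2 nW; have := dimv_sum_cap W1 W2; rewrite d1 d2.
have := dimvS (subvf (W1 + W2)); rewrite dim_full.
suff : (2 < \dim (W1 + W2))%N by lia.
rewrite ltnNge; apply: contra nW => le2.
have e1 : W1 == (W1 + W2)%VS by rewrite eqEdim addvSl d1.
have e2 : W2 == (W1 + W2)%VS by rewrite eqEdim addvSr d2.
by rewrite (eqP e1) -(eqP e2).
Qed.

Lemma PG2_join x y : x != y -> exists! l : {set point (PG2 F)},
  [/\ l \in lines (PG2 F), x \in l & y \in l].
Proof.
move=> nxy; have [v nzv xv] := PG2_point_vector x.
have [w nzw yw] := PG2_point_vector y.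
have wv : w \notin <[v]>%VS by rewrite -(PG2_point_neq xv yw nzw).
exists (PG2_line (<[v]> + <[w]>)); split.
  rewrite (mem_PG2_line _ xv) (mem_PG2_line _ yw); split.
  - by apply/PG2_lineP; exists (<[v]> + <[w]>)%VS; rewrite ?dim_plane.
  - by rewrite memvE addvSl.
  - by rewrite memvE addvSr.
move=> l [/PG2_lineP[W dW ->]].
by rewrite (mem_PG2_line _ xv) (mem_PG2_line _ yw) => vW wW; rewrite (planeE dW).
Qed.

Lemma PG2_meet (l m : {set point (PG2 F)}) :
  l \in lines (PG2 F) -> m \in lines (PG2 F) -> l != m ->
  exists! x : point (PG2 F), x \in l /\ x \in m.
Proof.
case/PG2_lineP=> W1 d1 ->; case/PG2_lineP=> W2 d2 -> nlm.
have nW : W1 != W2 by apply: contraNneq nlm => ->.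
have dc := dim_cap_lines d1 d2 nW.
exists (exist _ (W1 :&: W2)%VS (introT eqP dc) : PG2_point F).
split=> [|y []]; rewrite !inE /= ?capvSl ?capvSr // => y1 y2.
apply/val_inj/esym/eqP; rewrite eqEdim subv_cap y1 y2 /= dc.
by rewrite (eqP (valP y)).
Qed.

Lemma card_PG2_line W : \dim W = 2%N -> #|PG2_line W| = #|F|.+1.
Proof.
move=> dW; have nzW : W != 0%VS by rewrite -dimv_eq0 dW.
pose v := vpick W; have nzv : v != 0 by rewrite vpick0.
have vW : v \in W := memv_pick W.
have /subvPn[w wW wv] : ~~ (W <= <[v]>)%VS.
  by apply/negP=> /dimvS; rewrite dW dim_vline nzv.
have nz (c : F) : w + c *: v != 0.
  apply: contraNneq wv => /eqP; rewrite addr_eq0 => /eqP ->.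
  by rewrite -scaleNr memvZ ?memv_line.
have dv : \dim <[v]> == 1%N by rewrite dim_vline nzv.
have dc c : \dim <[w + c *: v]> == 1%N by rewrite dim_vline nz.
(* With [v], [w] a basis of [W], its points are <v> (the value at [None]) and the <w + c v> (the
   value at [Some c]). *)
pose g (o : option F) : PG2_point F :=
  if o is Some c then exist _ <[w + c *: v]>%VS (dc c) else exist _ <[v]>%VS dv.
have g_inj : injective g.
  have aux c : w + c *: v \notin <[v]>%VS.
    by rewrite rpredDr // memvZ ?memv_line.
  move=> [c|] [c'|] // /(congr1 val) /= E.
  - have : w + c *: v \in <[w + c' *: v]>%VS by rewrite -E memv_line.
    case/vlineP=> k ek; have [k1|nk1] := eqVneq k 1.
      move: ek; rewrite k1 scale1r => /addrI /eqP.
      rewrite -subr_eq0 -scalerBl scaler_eq0 (negbTE nzv) orbF subr_eq0.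
      by move/eqP->.
    have nz1k : 1 - k != 0 by rewrite subr_eq0 eq_sym.
    have e : (1 - k) *: w = (k * c' - c) *: v.
      apply/eqP; rewrite -subr_eq0; move/eqP: ek; rewrite -subr_eq0 => /eqP <-.
      by apply/eqP/rowP=> j; rewrite !mxE; ring.
    by case/negP: wv; rewrite -[w](scalerK nz1k) e !memvZ ?memv_line.
  - by case/negP: (aux c); rewrite -E memv_line.
  - by case/negP: (aux c'); rewrite E memv_line.
rewrite -card_option -(card_imset _ g_inj); apply/eq_card=> x.
have [u nzu xu] := PG2_point_vector x; rewrite (mem_PG2_line _ xu).
apply/idP/imsetP => [uW|[[c|] _ ex]]; last first.
- have : u \in <[v]>%VS by rewrite -[<[v]>%VS]/(val (g None)) -ex xu memv_line.
  by apply: subvP; rewrite -memvE.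
- have : u \in <[w + c *: v]>%VS.
    by rewrite -[<[_]>%VS]/(val (g (Some c))) -ex xu memv_line.
  by apply: subvP; rewrite -memvE rpredD // memvZ.
have [r [s eu]] := plane_comb dW vW wW nzv wv uW.
have [s0|nzs] := eqVneq s 0.
  exists None => //; apply/val_inj/eqP; rewrite /= xu eqEdim -memvE.
  by rewrite !dim_vline nzu nzv andbT eu s0 scale0r addr0 memvZ ?memv_line.
exists (Some (s^-1 * r)) => //; apply/val_inj/eqP; rewrite /= xu eqEdim -memvE.
rewrite !dim_vline nzu nz andbT.
have -> : u = s *: (w + (s^-1 * r) *: v).
  by rewrite scalerDr scalerA mulVKf // addrC.
by rewrite memvZ ?memv_line.
Qed.

Lemma PG2_has_order : has_order (PG2 F) #|F|.
Proof.
split=> [|l /PG2_lineP[W dW ->]]; last exact: card_PG2_line.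
exact: card_finNzRing_gt1.
Qed.

Lemma PG2_projective_plane : projective_plane (PG2 F).
Proof.
split; [split=> [l|x y] | split=> [x|l m]|].
- move=> /PG2_lineP[W dW ->]; rewrite card_PG2_line //.
  by apply: leq_trans (card_finNzRing_gt1 F) _.
- exact: PG2_join.
- have [v nzv xv] := PG2_point_vector x.
  have [|w wv] := @exists_notin <[v]>%VS; first by rewrite dim_vline nzv.
  have d1 := dim_plane nzv wv.
  have [|u] := @exists_notin (<[v]> + <[w]>)%VS; first by rewrite d1.
  move=> uvw; have uv : u \notin <[v]>%VS.
    by apply: contra uvw; apply: subvP; rewrite addvSl.
  have d2 := dim_plane nzv uv.
  apply/card_gt1P; exists (PG2_line (<[v]> + <[w]>)), (PG2_line (<[v]> + <[u]>)).
  split; rewrite 1?in_set ?(mem_PG2_line _ xv) ?memvE ?addvSl ?andbT.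
  + by apply/PG2_lineP; exists (<[v]> + <[w]>)%VS.
  + by apply/PG2_lineP; exists (<[v]> + <[u]>)%VS.
  have nzu : u != 0 by apply: contraNneq uv => ->; rewrite mem0v.
  have [y yu] := PG2_pointP nzu.
  apply/eqP=> /setP/(_ y); rewrite !(mem_PG2_line _ yu) (negbTE uvw).
  by rewrite memvE addvSr.
- exact: PG2_meet.
move=> l m /PG2_lineP[W1 d1 ->] /PG2_lineP[W2 d2 ->] nlm.
(* With [v] in [W1] only and [w] in [W2] only, [v + w] lies in neither plane. *)
have /subvPn[v v1 v2] : ~~ (W1 <= W2)%VS.
  apply: contra nlm => le; suff /eqP -> : W1 == W2 by [].
  by rewrite eqEdim le d1 d2.
have /subvPn[w w2 w1] : ~~ (W2 <= W1)%VS.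
  apply: contra nlm => le; suff /eqP -> : W2 == W1 by [].
  by rewrite eqEdim le d1 d2.
have n1 : v + w \notin W1 by rewrite rpredDl.
have nz : v + w != 0 by apply: contraNneq n1 => ->; rewrite mem0v.
have [x xvw] := PG2_pointP nz; exists x; rewrite !(mem_PG2_line _ xvw) n1.
by rewrite rpredDr.
Qed.

(** A computation in the basis [v1], [v2], [u1]: vectors for the three intersection points are
    linearly dependent, so the third lies in the plane of the other two. *)
Lemma PG2_pappian : pappian (PG2 F).
Proof.
move=> l m n a12 a21 a13 a31 a23 a32 A1 A2 A3 B1 B2 B3 C1 C2 /=.
case/and5P=> /PG2_lineP[Wl dl ->] /PG2_lineP[Wm dm ->] /PG2_lineP[Wn dn ->].
move=> /PG2_lineP[W12 d12 ->] /and5P[/PG2_lineP[W21 d21 ->]].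
move=> /PG2_lineP[W13 d13 ->] /PG2_lineP[W31 d31 ->] /PG2_lineP[W23 d23 ->].
move=> /andP[/PG2_lineP[W32 d32 ->] _].
have [v1 nzv1 vA1] := PG2_point_vector A1.
have [v2 nzv2 vA2] := PG2_point_vector A2.
have [v3 nzv3 vA3] := PG2_point_vector A3.
have [u1 nzu1 uB1] := PG2_point_vector B1.
have [u2 nzu2 uB2] := PG2_point_vector B2.
have [u3 nzu3 uB3] := PG2_point_vector B3.
have [w1 nzw1 wC1] := PG2_point_vector C1.
have [w2 nzw2 wC2] := PG2_point_vector C2.
rewrite !(mem_PG2_line _ vA1) !(mem_PG2_line _ vA2) !(mem_PG2_line _ vA3).
rewrite !(mem_PG2_line _ uB1) !(mem_PG2_line _ uB2) !(mem_PG2_line _ uB3).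
rewrite !(mem_PG2_line _ wC1) !(mem_PG2_line _ wC2).
move=> /and3P[v1l v2l v3l] /and3P[u1m u2m u3m].
move=> /and5P[v1a12 v1a13 v2a21 v2a23 /andP[v3a31 v3a32]].
move=> /and5P[u1a21 u1a31 u2a12 u2a32 /andP[u3a13 u3a23]].
move=> /and3P[w1n w1a23 w1a32] /and3P[w2n w2a13 w2a31].
move=> /and3P[v1m v2m v3m] /and3P[u1l u2l u3l].
rewrite !inE !negb_or -!andbA => /and4P[nA12 nA13 nA23 _] /and4P[nB12 nB13 nB23 _].
rewrite (PG2_point_neq vA1 vA2 nzv2) in nA12.
rewrite (PG2_point_neq vA2 vA3 nzv3) in nA23.
rewrite (PG2_point_neq uB1 uB2 nzu2) in nB12.
have [s [t ev3]] := plane_comb dl v1l v2l nzv1 nA12 v3l.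
have [k [b eu3]] := plane_comb dm u1m u2m nzu1 nB12 u3m.
have dlu : (Wl + <[u1]> = fullv)%VS.
  by apply/eqP; rewrite eqEdim subvf dim_full dim_add_vline // dl.
have [x [y [z eu2]]] : exists x y z : F, u2 = x *: v1 + y *: v2 + z *: u1.
  have : u2 \in (Wl + <[u1]>)%VS by rewrite dlu memvf.
  case/memv_addP=> a al [c /vlineP[z ->] ->].
  by have [x [y ->]] := plane_comb dl v1l v2l nzv1 nA12 al; exists x, y, z.
(* Three scalars must not vanish: [s] as A2 and A3 differ, [k + b * z] as B3 is off [l], and
   [s * y - x * t] as otherwise A3 would be on [m] or B1 and B2 would coincide. *)
have nzs : s != 0.
  by apply: contraNneq nA23 => s0; rewrite ev3 s0 scale0r add0r memvZ ?memv_line.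
have nzkb : k + b * z != 0.
  apply: contraNneq u3l => e0.
  have -> : u3 = b *: (x *: v1 + y *: v2) + (k + b * z) *: u1.
    by rewrite eu3 eu2; apply/rowP=> j; rewrite !mxE; ring.
  by rewrite e0 scale0r addr0 memvZ // rpredD // memvZ.
have nzst : s * y - x * t != 0.
  apply/negP=> /eqP e0.
  have e : x *: v3 = s *: (u2 - z *: u1).
    apply/eqP; rewrite -subr_eq0; apply/eqP.
    transitivity (- (s * y - x * t) *: v2); last by rewrite e0 oppr0 scale0r.
    by rewrite ev3 eu2; apply/rowP=> j; rewrite !mxE; ring.
  have [x0|nzx] := eqVneq x 0.
    move/eqP: e; rewrite x0 scale0r eq_sym scaler_eq0 (negbTE nzs) subr_eq0 => /eqP e.
    by case/negP: nB12; rewrite e memvZ ?memv_line.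
  by case/negP: v3m; rewrite -[v3](scalerK nzx) e !memvZ // rpredB // memvZ.
have nz2 : z *: u1 + y *: v2 != 0.
  have nzz : z != 0.
    apply: contraNneq u2l => z0.
    by rewrite eu2 z0 scale0r addr0 rpredD // memvZ.
  apply: contra u1l; rewrite addr_eq0 => /eqP e.
  by rewrite -[u1](scalerK nzz) e !(memvZ, rpredN).
(* Two distinct planes meet in the line spanned by [w], so any common vector is a multiple of [w]
   and lies in [Wn] with it. *)
have common W W' w c : \dim W = 2%N -> \dim W' = 2%N -> W != W' -> w != 0 ->
    w \in W -> w \in W' -> c \in W -> c \in W' -> w \in Wn -> c \in Wn.
  move=> dW dW' nW nzw wW wW' cW cW' wn.
  suff : c \in <[w]>%VS by apply: subvP; rewrite -memvE.
  rewrite (_ : <[w]>%VS = (W :&: W')%VS) ?memv_cap ?cW ?cW' //.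
  apply/eqP; rewrite eqEdim dim_cap_lines // dim_vline nzw andbT.
  by rewrite -memvE memv_cap wW.
(* If the two planes were equal, they would contain A2 and A3, hence be [Wl], and B3 would lie on
   [l]. *)
have nW23 : W23 != W32.
  apply: contraNneq u3l => e; have <- : W23 = Wl.
    rewrite -(planeE dl v2l v3l nzv2 nA23) -(planeE d23 v2a23 _ nzv2 nA23) //.
    by rewrite e.
  by [].
have nA13' : v3 \notin <[v1]>%VS.
  by rewrite -(PG2_point_neq vA1 vA3 nzv3).
have nW13 : W13 != W31.
  apply: contraNneq u3l => e; have <- : W13 = Wl.
    rewrite -(planeE dl v1l v3l nzv1 nA13') -(planeE d13 v1a13 _ nzv1 nA13') //.
    by rewrite e.
  by [].
(* [c1] lies in [W32] by definition and in [W23] once rewritten in terms of [u3] and [v2]; likewise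
   [c2] lies in [W31] and [W13]. *)
pose c1 := (s * (k + b * z)) *: u2 - (k * x) *: v3.
pose c2 := (b * y) *: v3 + (t * (k + b * z)) *: u1.
have c1n : c1 \in Wn.
  apply: (common W23 W32 w1) => //.
    have -> : c1 = (s * z) *: u3 + (s * k * y - k * x * t) *: v2.
      by rewrite /c1 eu3 ev3 eu2; apply/rowP=> j; rewrite !mxE; ring.
    by rewrite rpredD // memvZ.
  by rewrite rpredB // !memvZ.
have c2n : c2 \in Wn.
  apply: (common W13 W31 w2) => //.
    have -> : c2 = t *: u3 + (b * y * s - t * b * x) *: v1.
      by rewrite /c2 eu3 ev3 eu2; apply/rowP=> j; rewrite !mxE; ring.
    by rewrite rpredD // memvZ.
  by rewrite rpredD // !memvZ.
have [C3 C3v] := PG2_pointP nz2; exists C3.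
rewrite !(mem_PG2_line _ C3v); apply/and3P; split.
- rewrite -[z *: u1 + _](scalerK (mulf_neq0 nzkb nzst)) memvZ //.
  have -> : ((k + b * z) * (s * y - x * t)) *: (z *: u1 + y *: v2)
          = y *: c1 - (z * x) *: c2.
    by rewrite /c1 /c2 ev3 eu2; apply/rowP=> j; rewrite !mxE; ring.
  by rewrite rpredB // memvZ.
- have -> : z *: u1 + y *: v2 = u2 - x *: v1.
    by rewrite eu2; apply/rowP=> j; rewrite !mxE; ring.
  by rewrite rpredB // memvZ.
- by rewrite rpredD // memvZ.
Qed.

End PG2Plane.

(** * Transfer of Pappus' theorem *)

(** Only incidences and non-incidences with the nine lines are transferred. The distinctness of the
    points is therefore first expressed by a line containing one point and not the other. *)
Lemma pappian_transfer p (X Y : incidence_system) :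
  prime p ->
  projective_plane X -> has_order X p ->
  projective_plane Y -> has_order Y p ->
  (forall w : word p (point X), w \in code p X ->
     exists2 v : word p (point Y), v \in code p Y & word_type v = word_type w) ->
  2 ^ 9 <= p -> pappian Y -> pappian X.
Proof.
move=> p_pr plX ordX plY ordY types le29p papY.
move=> l m n a12 a21 a13 a31 a23 a32 A1 A2 A3 B1 B2 B3 C1 C2.
set s := [:: l; m; n; a12; a21; a13; a31; a23; a32] => lines_s.
move=> /and3P[A1l A2l A3l] /and3P[B1m B2m B3m].
move=> /and5P[A1a12 A1a13 A2a21 A2a23 /andP[A3a31 A3a32]].
move=> /and5P[B1a21 B1a31 B2a12 B2a32 /andP[B3a13 B3a23]].
move=> /and3P[C1n C1a23 C1a32] /and3P[C2n C2a13 C2a31].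
move=> /and3P[A1m A2m A3m] /and3P[B1l B2l B3l].
rewrite /= !inE !negb_or -!andbA => /and4P[nA12 nA13 nA23 _] /and4P[nB12 nB13 nB23 _].
pose L (i : 'I_9) := nth set0 s i.
have lL i : L i \in lines X by apply: (allP lines_s); apply: mem_nth; case: i.
have small : 9 * 9.+1 <= p by apply: leq_trans le29p.
have [M [lM toY toX]] :=
  line_patterns_transfer p_pr plX ordX plY ordY types le29p small lL.
pose o j (lt : j < 9) : 'I_9 := Ordinal lt.
have lineX j (lt : j < 9) : nth set0 s j \in lines X := lL (o j lt).
(* A line through [P] and a point off line [j] meets line [j] only in [P]. The indices follow the
   order of [s]: 0, 1, 3, 4 are [l], [m], [a12], [a21]. *)
have distinct (P Q R : point X) j k (ltj : j < 9) (ltk : k < 9) :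
    P != Q -> P \in nth set0 s j -> Q \in nth set0 s j ->
    P \in nth set0 s k -> R \in nth set0 s k -> R \notin nth set0 s j ->
    Q \notin nth set0 s k.
  move=> nPQ Pj Qj Pk Rk; apply: contraNN => Qk.
  by rewrite -(line_eq plX (lineX k ltk) (lineX j ltj) nPQ).
have A2a12 := distinct A1 A2 B2 0 3 isT isT nA12 A1l A2l A1a12 B2a12 B2l.
have A3a12 := distinct A1 A3 B2 0 3 isT isT nA13 A1l A3l A1a12 B2a12 B2l.
have A3a21 := distinct A2 A3 B1 0 4 isT isT nA23 A2l A3l A2a21 B1a21 B1l.
have B2a21 := distinct B1 B2 A2 1 4 isT isT nB12 B1m B2m B1a21 A2a21 A2m.
have B3a21 := distinct B1 B3 A2 1 4 isT isT nB13 B1m B3m B1a21 A2a21 A2m.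
have B3a12 := distinct B2 B3 A1 1 3 isT isT nB23 B2m B3m B2a12 A1a12 A1m.
have {}toY x : exists y, forall j (lt : j < 9), (y \in M (o j lt)) = (x \in nth set0 s j).
  by have [y yx] := toY x; exists y => j lt; rewrite yx.
have [A1' eA1] := toY A1; have [A2' eA2] := toY A2; have [A3' eA3] := toY A3.
have [B1' eB1] := toY B1; have [B2' eB2] := toY B2; have [B3' eB3] := toY B3.
have [C1' eC1] := toY C1; have [C2' eC2] := toY C2.
have sep (P' Q' : point Y) j (lt : j < 9) :
    (P' \in M (o j lt)) != (Q' \in M (o j lt)) -> P' != Q'.
  by apply: contraNneq => ->.
have [|||||||||||C3' /and3P[C3n C3a12 C3a21]] := papY
  (M (o 0 isT)) (M (o 1 isT)) (M (o 2 isT)) (M (o 3 isT)) (M (o 4 isT))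
  (M (o 5 isT)) (M (o 6 isT)) (M (o 7 isT)) (M (o 8 isT))
  A1' A2' A3' B1' B2' B3' C1' C2'.
- by rewrite /= !lM.
- by rewrite eA1 eA2 eA3; apply/and3P.
- by rewrite eB1 eB2 eB3; apply/and3P.
- by rewrite !eA1 !eA2 !eA3 /= A1a12 A1a13 A2a21 A2a23 A3a31.
- by rewrite !eB1 !eB2 !eB3 /= B1a21 B1a31 B2a12 B2a32 B3a13.
- by rewrite !eC1; apply/and3P.
- by rewrite !eC2; apply/and3P.
- by rewrite eA1 eA2 eA3; apply/and3P.
- by rewrite eB1 eB2 eB3; apply/and3P.
- rewrite /= !inE !negb_or -!andbA; apply/and4P; split=> //.
  + by apply: (sep _ _ 3 isT); rewrite eA1 eA2 /= A1a12 A2a12.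
  + by apply: (sep _ _ 3 isT); rewrite eA1 eA3 /= A1a12 A3a12.
  + by apply: (sep _ _ 4 isT); rewrite eA2 eA3 /= A2a21 A3a21.
- rewrite /= !inE !negb_or -!andbA; apply/and4P; split=> //.
  + by apply: (sep _ _ 4 isT); rewrite eB1 eB2 /= B1a21 (negbTE B2a21).
  + by apply: (sep _ _ 4 isT); rewrite eB1 eB3 /= B1a21 (negbTE B3a21).
  + by apply: (sep _ _ 3 isT); rewrite eB2 eB3 /= B2a12 (negbTE B3a12).
have [C3 eC3] := toX C3'; exists C3.
by move: C3n C3a12 C3a21; rewrite !eC3 => *; apply/and3P.
Qed.

(** * Coordinates from the Thomsen and hexagon conditions *)

(** [g] maps the orbit of [x] bijectively onto the orbit of [g x]. *)
Lemma order_commute (T : finType) (f g : T -> T) x :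
  injective g -> (forall y, g (f y) = f (g y)) -> order f (g x) = order f x.
Proof.
move=> g_inj gf; rewrite /order -(card_imset (fconnect f x) g_inj).
have giter k y : g (iter k f y) = iter k f (g y).
  by elim: k => //= k <-; rewrite gf.
apply/eq_card=> y; apply/idP/imsetP => [|[z fz ->]].
  by rewrite inE => /iter_findex <-; exists (iter (findex f (g x) y) f x);
    rewrite ?giter // -topredE /= fconnect_iter.
by have /iter_findex <- : fconnect f x z := fz; rewrite giter inE fconnect_iter.
Qed.

(* I is the set of points at infinity, and cl c P stands for the line joining c
   and P. *)
Section AffinePlane.
Variables (A : finType) (I K : eqType) (cl : I -> A -> K) (p : nat).
Implicit Types (P Q R : A) (c d x y z w : I).

Hypothesis p_pr : prime p.
Hypothesis cross_exists : forall c d P Q, c != d ->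
  exists R, cl c R = cl c P /\ cl d R = cl d Q.
Hypothesis cross_uniq : forall c d P Q, c != d ->
  cl c P = cl c Q -> cl d P = cl d Q -> P = Q.
Hypothesis card_class : forall c P, #|[set Q | cl c Q == cl c P]| = p.

(* Both conditions are Pappus configurations: in [thomsen] the three points x, y, z
   at infinity are pairwise not joined by the nine lines; in [hexagon] the line at
   infinity is one of the nine, and P, E, C and Q, D, B lie on two parallel lines. *)
Definition thomsen x y z := forall Q1 Q2 Q3 Q4 Q5 Q6,
  cl x Q1 = cl x Q2 -> cl x Q4 = cl x Q5 ->
  cl y Q2 = cl y Q5 -> cl y Q1 = cl y Q6 -> cl y Q3 = cl y Q4 ->
  cl z Q1 = cl z Q4 -> cl z Q2 = cl z Q3 -> cl z Q5 = cl z Q6 ->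
  cl x Q3 = cl x Q6.

Definition hexagon y x z w := forall P C E Q B D,
  cl y P = cl y C -> cl y P = cl y E -> cl y Q = cl y B -> cl y Q = cl y D ->
  cl x Q = cl x C -> cl x E = cl x D -> cl z C = cl z B -> cl z D = cl z P ->
  cl w P = cl w Q -> cl w B = cl w E.

Lemma other_exists c P : exists2 Q, Q != P & cl c Q = cl c P.
Proof.
have : 1 < #|[set Q | cl c Q == cl c P]| by rewrite card_class prime_gt1.
case/card_gt1P=> Q [R]; rewrite !inE => -[/eqP cQ /eqP cR nQR].
by have [eQP|] := eqVneq Q P; [exists R; rewrite // -eQP eq_sym | exists Q].
Qed.

(** * Coordinates of a 3-net satisfying the Thomsen condition *)

Section Net.
Variables (x y z : I).
Hypotheses (nxy : x != y) (nyz : y != z) (nxz : x != z) (tho : thomsen x y z).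

Definition cross c d P Q := odflt P [pick R | (cl c R == cl c P) && (cl d R == cl d Q)].

Lemma crossP c d P Q : c != d ->
  cl c (cross c d P Q) = cl c P /\ cl d (cross c d P Q) = cl d Q.
Proof.
move=> ncd; rewrite /cross; case: pickP => [R /andP[/eqP -> /eqP ->] //|H].
have [R [cR dR]] := cross_exists P Q ncd.
by have := H R; rewrite cR dR !eqxx.
Qed.

(* Shift of the y-line of P: along z to the y-line of M, and back along x. *)
Definition shift M P := cross y x P (cross z y P M).

Lemma shiftP M P : exists R,
  [/\ cl z R = cl z P, cl y R = cl y M, cl y (shift M P) = cl y P
    & cl x (shift M P) = cl x R].
Proof.
have nzy : z != y by rewrite eq_sym.
have nyx : y != x by rewrite eq_sym.
have [zR yR] := crossP P M nzy; exists (cross z y P M).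
by have [? ?] := crossP P (cross z y P M) nyx; split.
Qed.

Lemma shift_class M P : cl y (shift M P) = cl y P.
Proof. by have [R []] := shiftP M P. Qed.

Lemma shift_inj M : injective (shift M).
Proof.
move=> P Q e; have [R [zR yR yP xP]] := shiftP M P.
have [S [zS yS yQ xQ]] := shiftP M Q.
have eRS : R = S by apply: (cross_uniq nxy); congruence.
by apply: (cross_uniq nyz); congruence.
Qed.

Lemma shift_commute M N P : shift M (shift N P) = shift N (shift M P).
Proof.
have [Q1 [zQ1 yQ1 yQ2 xQ2]] := shiftP N P.
have [Q3 [zQ3 yQ3 yMN xMN]] := shiftP M (shift N P).
have [Q4 [zQ4 yQ4 yQ5 xQ5]] := shiftP M P.
have [Q6 [zQ6 yQ6 yNM xNM]] := shiftP N (shift M P).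
apply: (cross_uniq nxy); last congruence.
rewrite xMN xNM; apply: (tho (Q1 := Q1) (Q2 := shift N P) (Q4 := Q4)
  (Q5 := shift M P)); congruence.
Qed.

Lemma shift_trans P Q : cl y P = cl y Q -> exists M, shift M P = Q.
Proof.
move=> yPQ; have nzx : z != x by rewrite eq_sym.
have [M [zM xM]] := cross_exists P Q nzx.
exists M; have [R [zR yR yP xP]] := shiftP M P.
have eRM : R = M by apply: (cross_uniq nyz); congruence.
by apply: (cross_uniq nxy); congruence.
Qed.

Lemma shift_fixed M P : shift M P = P -> cl y M = cl y P.
Proof.
move=> e; have [R [zR yR yP xP]] := shiftP M P.
have eRP : R = P by apply: (cross_uniq nxz); congruence.
by rewrite -yR eRP.
Qed.

(** [T] permutes the p points of the y-line [D] of [O]. Its orbits there have equal length, because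
    the shifts commute with [T] and are transitive on [D]; so [D] is one p-cycle. The coordinates
    are the positions on this cycle of the projections of a point to [D] along x and along z. *)
Lemma net_coordinates (O : A) : exists a b : A -> 'F_p,
  [/\ forall P Q, a P = a Q <-> cl x P = cl x Q,
      forall P Q, b P = b Q <-> cl z P = cl z Q,
      forall P Q, (a P - b P = a Q - b Q)%R <-> cl y P = cl y Q
    & forall i j, exists P, a P = i /\ b P = j].
Proof.
(* [M1] is off the y-line of [O], so that the shift by [M1] moves [O]. *)
have [M1 nM1O xM1] := other_exists x O.
have yM1 : cl y M1 <> cl y O by move=> e; case/eqP: nM1O; apply: (cross_uniq nxy).
pose T := shift M1; have T_inj : injective T := @shift_inj M1.
pose D := [pred P | cl y P == cl y O].
have cardD : #|D| = p by rewrite -(card_class y O) cardsE.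
have DP P : reflect (cl y P = cl y O) (P \in D) := eqP.
have orderT P : P \in D -> order T P = order T O.
  move/DP=> yP; have [M <-] := shift_trans (esym yP).
  by apply: order_commute => [|Q]; [apply: shift_inj | apply: shift_commute].
have DT : fclosed T D.
  by move=> P Q /eqP <-; rewrite !inE shift_class.
have orderO : order T O = p.
  have /(fcard_order_set T_inj)/(_ DT) : D \subset order_set T (order T O).
    by apply/subsetP=> P /orderT e; rewrite inE /= e.
  rewrite cardD => e; have : order T O %| p by rewrite -e dvdn_mull.
  case/primeP: p_pr => _ /[apply] /orP[/eqP o1|/eqP //].
  by case: yM1; apply: shift_fixed; have := iter_order T_inj O; rewrite o1.
have connectD P : (fconnect T O P) = (P \in D).
  have sub : fconnect T O \subset D.
    by apply/subsetP=> Q /(closed_connect DT) <-; rewrite inE.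
  have eqc : #|fconnect T O| = #|D| by rewrite cardD -orderO.
  by rewrite -[fconnect T O P]/(P \in fconnect T O) (subset_cardP eqc sub).
have iterT k : iter (k %% p) T O = iter k T O.
  rewrite {2}(divn_eq k p) addnC iterD; congr (iter _ T _).
  elim: (k %/ p) => //= m IH.
  by rewrite mulSn iterD -IH -orderO (iter_order T_inj).
pose lg P : 'F_p := ((findex T O P)%:R)%R.
have lg_iter k : lg (iter k T O) = (k%:R)%R.
  rewrite /lg -iterT findex_iter ?orderO ?ltn_mod ?prime_gt0 //.
  exact: Fp_nat_mod.
have lgK P : P \in D -> exists2 k, P = iter k T O & lg P = (k%:R)%R.
  rewrite -connectD => /iter_findex e; exists (findex T O P) => //.
have lg_inj : {in D &, injective lg}.
  move=> P Q /lgK[k -> lP] /lgK[j -> lQ]; rewrite lP lQ => /(natr_Fp_eq p_pr) e.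
  by rewrite -iterT e iterT.
(* Commuting with [T], every shift acts on the cycle as a translation. *)
have lg_shift M P : P \in D -> (lg (shift M P) = lg P + lg (shift M O))%R.
  move=> /lgK[k -> ->].
  have -> : shift M (iter k T O) = iter k T (shift M O).
    by elim: k => //= k <-; rewrite shift_commute.
  have /lgK[j -> ->] : shift M O \in D by rewrite inE shift_class.
  by rewrite -iterD lg_iter natrD.
have nyx : y != x by rewrite eq_sym.
pose px := cross y x O; pose pz := cross y z O.
have pxP P : px P \in D /\ cl x (px P) = cl x P.
  by have [yP xP] := crossP O P nyx; rewrite inE yP.
have pzP P : pz P \in D /\ cl z (pz P) = cl z P.
  by have [yP zP] := crossP O P nyz; rewrite inE yP.
have iffx P Q : lg (px P) = lg (px Q) <-> cl x P = cl x Q.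
  have [DP1 xP] := pxP P; have [DQ1 xQ] := pxP Q; split=> [|e].
    by move/(lg_inj _ _ DP1 DQ1) => e; congruence.
  congr lg; apply: (cross_uniq nxy); first congruence.
  by rewrite (DP _ DP1) (DP _ DQ1).
have iffz P Q : lg (pz P) = lg (pz Q) <-> cl z P = cl z Q.
  have [DP1 xP] := pzP P; have [DQ1 xQ] := pzP Q; split=> [|e].
    by move/(lg_inj _ _ DP1 DQ1) => e; congruence.
  congr lg; apply: (cross_uniq nyz); last congruence.
  by rewrite (DP _ DP1) (DP _ DQ1).
(* The shift by [P] takes the z-projection of [P] to its x-projection. *)
have sub P : (lg (px P) - lg (pz P) = lg (shift P O))%R.
  have [Dx xP] := pxP P; have [Dz zP] := pzP P.
  have -> : px P = shift P (pz P).
    have [R [zR yR yS xS]] := shiftP P (pz P).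
    have eRP : R = P by apply: (cross_uniq nyz); congruence.
    by apply: (cross_uniq nxy); rewrite ?yS ?(DP _ Dx) ?(DP _ Dz); congruence.
  by rewrite lg_shift // addrC addKr.
have rowE P Q : cl y P = cl y Q -> lg (shift P O) = lg (shift Q O).
  move=> e; congr lg; have [R [zR yR yS xS]] := shiftP P O.
  have [S [zS yS' yS2 xS2]] := shiftP Q O.
  have eRS : R = S by apply: (cross_uniq nyz); congruence.
  by apply: (cross_uniq nxy); congruence.
have lg_onto i : exists2 P, P \in D & lg P = i.
  exists (iter i T O); last by rewrite lg_iter natr_val_Fp.
  by rewrite -connectD fconnect_iter.
have onto i j : exists P, lg (px P) = i /\ lg (pz P) = j.
  have [Q1 D1 <-] := lg_onto i; have [Q2 D2 <-] := lg_onto j.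
  have [P [xP zP]] := cross_exists Q1 Q2 nxz; exists P.
  have [Dx xP'] := pxP P; have [Dz zP'] := pzP P.
  split; congr lg.
    by apply: (cross_uniq nxy); rewrite ?(DP _ Dx) ?(DP _ D1); congruence.
  by apply: (cross_uniq nyz); rewrite ?(DP _ Dz) ?(DP _ D2); congruence.
exists (fun P => lg (px P)), (fun P => lg (pz P)); split=> // P Q.
rewrite !sub; split=> [e|]; last exact: rowE.
(* [R] has the same second coordinate and the same difference as [Q], hence equals [Q], and it lies
   on the y-line of [P]. *)
have [R [yR zR]] := cross_exists P Q nyz.
have ez : lg (pz R) = lg (pz Q) by apply/iffz.
have ex : lg (px R) = lg (px Q).
  apply/(addIr (- lg (pz Q))%R); rewrite -{1}ez !sub -e.
  exact: rowE.
have -> // : Q = R.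
by apply/esym/(cross_uniq nxz); [apply/iffx|].
Qed.

End Net.

Section Shift.
Variables (c1 c2 c3 : I) (f1 f2 f3 : A -> 'F_p).
Local Open Scope ring_scope.
Hypothesis (n12 : c1 != c2).
Hypothesis (sum0 : forall P, f1 P + f2 P + f3 P = 0).
Hypothesis (f1P : forall P Q, f1 P = f1 Q <-> cl c1 P = cl c1 Q).
Hypothesis (f2P : forall P Q, f2 P = f2 Q <-> cl c2 P = cl c2 Q).
Hypothesis (f3P : forall P Q, f3 P = f3 Q <-> cl c3 P = cl c3 Q).
Hypothesis (onto : forall i j, exists P, f1 P = i /\ f2 P = j).

(** One hexagon moves [P] and [Q] along their c1-lines by [f1 P - f1 Q]. If this is nonzero, its
    multiples exhaust F_p, so iteration reaches every [e]; if it is zero, then P = Q. *)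
Lemma hexagon_shift w P Q P' Q' e : w != c1 -> hexagon c1 c2 c3 w ->
  f1 P' = f1 P -> f1 Q' = f1 Q -> f2 P' = f2 P + e -> f2 Q' = f2 Q + e ->
  cl w P = cl w Q -> cl w P' = cl w Q'.
Proof.
move=> nw hex p1 q1 p2 q2 wPQ; have f3E R : f3 R = - f1 R - f2 R.
  by rewrite -[RHS]addr0 -(sum0 R); ring.
have once R S R' S' : f1 R' = f1 R -> f1 S' = f1 S -> f2 R' = f2 R + (f1 R - f1 S) ->
    f2 S' = f2 S + (f1 R - f1 S) -> cl w R = cl w S -> cl w R' = cl w S'.
  move=> r1 s1 r2 s2 wRS.
  have [C [C1 C2]] := onto (f1 R) (f2 S); have [D [D1 D2]] := onto (f1 S) (f2 R').
  symmetry; apply: (hex R C R' S S' D) => //.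
  - by apply/f1P.
  - by apply/f1P.
  - by apply/f1P.
  - by apply/f1P.
  - by apply/f2P.
  - by apply/f2P.
  - by apply/f3P; rewrite !f3E C1 C2 s1 s2; ring.
  - by apply/f3P; rewrite !f3E D1 D2 r2; ring.
have many k : forall R S R' S', f1 R' = f1 R -> f1 S' = f1 S ->
    f2 R' = f2 R + (f1 R - f1 S) *+ k -> f2 S' = f2 S + (f1 R - f1 S) *+ k ->
    cl w R = cl w S -> cl w R' = cl w S'.
  elim: k => [|k IH] R S R' S' r1 s1 r2 s2 wRS.
    rewrite !mulr0n !addr0 in r2 s2.
    have -> : R' = R by apply: (cross_uniq n12); [apply/f1P | apply/f2P].
    suff -> : S' = S by [].
    by apply: (cross_uniq n12); [apply/f1P | apply/f2P].
  have [R1 [r11 r12]] := onto (f1 R) (f2 R + (f1 R - f1 S)).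
  have [S1 [s11 s12]] := onto (f1 S) (f2 S + (f1 R - f1 S)).
  apply: (IH R1 S1); rewrite ?r11 ?s11 // ?r12 ?s12.
  - by rewrite r2 mulrS addrA.
  - by rewrite s2 mulrS addrA.
  exact: (once R S).
have [e0|nz] := eqVneq (f1 P - f1 Q) 0.
  have ePQ : P = Q.
    by apply: (cross_uniq nw) => //; apply/f1P; apply/eqP; rewrite -subr_eq0 e0.
  suff -> : P' = Q' by [].
  by apply: (cross_uniq n12); [apply/f1P | apply/f2P];
    rewrite ?p1 ?q1 ?p2 ?q2 ePQ.
have ek : (f1 P - f1 Q) *+ (e / (f1 P - f1 Q) : 'F_p) = e.
  by rewrite -mulr_natr natr_val_Fp mulrC divfK.
by apply: (many (e / (f1 P - f1 Q) : 'F_p) P Q); rewrite ?ek.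
Qed.

End Shift.

Lemma affine_coordinates x y z (O : A) :
  uniq [:: x; y; z] -> thomsen x y z ->
  (forall c1 c2 c3 c4, uniq [:: c1; c2; c3; c4] -> hexagon c1 c2 c3 c4) ->
  exists f g : A -> 'F_p,
    [/\ forall i j, exists P, f P = i /\ g P = j,
        forall P Q, f P = f Q -> g P = g Q -> P = Q
      & forall w, exists u v : 'F_p, (u, v) <> (0, 0)%R /\ forall P Q,
          cl w P = cl w Q <-> (u * (f P - f Q) + v * (g P - g Q) = 0)%R].
Proof.
rewrite /= !inE !negb_or -!andbA => /and4P[nxy nxz nyz _] tho hex.
have [f [b [fP bP dP onto]]] := net_coordinates nxy nyz nxz tho O.
(* The signs make f + g + h = 0, so that [hexagon_shift] applies with the roles of [f] and [g]
   exchanged as well. *)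
pose g P : 'F_p := (- b P)%R; pose h P : 'F_p := (b P - f P)%R.
have gP P Q : g P = g Q <-> cl z P = cl z Q.
  by rewrite -bP; split=> [/oppr_inj|e] //; congr (- _)%R.
have hP P Q : h P = h Q <-> cl y P = cl y Q.
  rewrite -dP; split=> e; first by rewrite -!(opprB (b _)); congr (- _)%R.
  by rewrite /h -!(opprB (f _)) e.
have onto' i j : exists P, f P = i /\ g P = j.
  by have [P [Pi Pj]] := onto i (- j)%R; exists P; rewrite /g Pj opprK.
have onto'' i j : exists P, g P = i /\ f P = j.
  by have [P [? ?]] := onto' j i; exists P.
have fg_inj P Q : f P = f Q -> g P = g Q -> P = Q.
  by move=> /fP xPQ /gP zPQ; apply: (cross_uniq nxz).
have nzx : z != x by rewrite eq_sym.
have shift_f w P Q P' Q' e : f P' = f P -> f Q' = f Q ->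
    (g P' = g P + e)%R -> (g Q' = g Q + e)%R -> cl w P = cl w Q -> cl w P' = cl w Q'.
  move=> p1 q1 p2 q2 wPQ.
  have [ewx|nwx] := eqVneq w x.
    by rewrite ewx; apply/fP; rewrite p1 q1; apply/fP; rewrite -ewx.
  have [ewz|nwz] := eqVneq w z.
    by rewrite ewz; apply/gP; rewrite p2 q2; congr (_ + _)%R; apply/gP; rewrite -ewz.
  have [ewy|nwy] := eqVneq w y.
    rewrite ewy in wPQ *; move/hP: wPQ => hPQ; apply/hP.
    move: hPQ; rewrite /h p1 q1; move: p2 q2; rewrite /g => p2 q2.
    rewrite -[b P']opprK -[b Q']opprK p2 q2 !opprD !opprK => hPQ.
    by rewrite addrAC hPQ addrAC.
  apply: (@hexagon_shift x z y f g h nxz _ fP gP hP onto' w P Q P' Q' e) => //.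
    by move=> R; rewrite /g /h; ring.
  apply: hex; rewrite /= !inE !negb_or nxz nxy (eq_sym z y) nyz.
  by rewrite (eq_sym x w) (eq_sym z w) (eq_sym y w) nwx nwz nwy.
have shift_g w P Q P' Q' e : (f P' = f P + e)%R -> (f Q' = f Q + e)%R ->
    g P' = g P -> g Q' = g Q -> cl w P = cl w Q -> cl w P' = cl w Q'.
  move=> p1 q1 p2 q2 wPQ.
  have [ewx|nwx] := eqVneq w x.
    by rewrite ewx; apply/fP; rewrite p1 q1; congr (_ + _)%R; apply/fP; rewrite -ewx.
  have [ewz|nwz] := eqVneq w z.
    by rewrite ewz; apply/gP; rewrite p2 q2; apply/gP; rewrite -ewz.
  have [ewy|nwy] := eqVneq w y.
    rewrite ewy in wPQ *; move/hP: wPQ => hPQ; apply/hP.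
    move: hPQ p2 q2; rewrite /h /g p1 q1 => hPQ /oppr_inj -> /oppr_inj ->.
    by rewrite !opprD !addrA hPQ.
  apply: (@hexagon_shift z x y g f h nzx _ gP fP hP onto'' w P Q P' Q' e) => //.
    by move=> R; rewrite /g /h; ring.
  apply: hex; rewrite /= !inE !negb_or nzx nxy (eq_sym z y) nyz.
  by rewrite (eq_sym x w) (eq_sym z w) (eq_sym y w) nwx nwz nwy.
have translate w P Q P' Q' (s t : 'F_p) : (f P' = f P + s)%R -> (f Q' = f Q + s)%R ->
    (g P' = g P + t)%R -> (g Q' = g Q + t)%R -> cl w P = cl w Q -> cl w P' = cl w Q'.
  move=> p1 q1 p2 q2 wPQ.
  have [R [R1 R2]] := onto' (f P + s)%R (g P).
  have [S [S1 S2]] := onto' (f Q + s)%R (g Q).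
  apply: (shift_f w R S P' Q' t); rewrite ?R1 ?S1 ?R2 ?S2 //.
  by apply: (shift_g w P Q R S s).
exists f, g; split=> // w.
(* The vector (dx, dy) from [O] to [Q0] is a direction of the w-lines; the linear form sought is dy
   f - dx g. *)
have [Q0 nQ0 wQ0] := other_exists w O.
pose dx := (f Q0 - f O)%R; pose dy := (g Q0 - g O)%R.
(* Each step is a translate of the pair [O], [Q0]. *)
have multiple k P Q : (f Q = f P + dx *+ k)%R -> (g Q = g P + dy *+ k)%R ->
    cl w P = cl w Q.
  elim: k Q => [|k IH] Q; first by rewrite !mulr0n !addr0 => q1 q2; congr cl; apply/esym/fg_inj.
  rewrite !mulrSr !addrA => q1 q2.
  have [R [r1 r2]] := onto' (f P + dx *+ k)%R (g P + dy *+ k)%R.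
  rewrite (IH R) //; apply: (translate w O Q0 R Q (f R - f O) (g R - g O))%R => //.
  - by ring.
  - by rewrite q1 r1 /dx; ring.
  - by ring.
  - by rewrite q2 r2 /dy; ring.
have natF (i : 'F_p) (t : 'F_p) : (t *+ i = i * t)%R.
  by rewrite -mulr_natl natr_val_Fp.
exists dy, (- dx)%R; split=> [e|P Q].
  have e0 : dy = 0%R := congr1 fst e.
  have /eqP d0 : (- dx = 0)%R := congr1 snd e.
  rewrite oppr_eq0 in d0; case/eqP: nQ0; apply: fg_inj.
    by apply/eqP; rewrite -subr_eq0 -/dx.
  by apply/eqP; rewrite -subr_eq0 -/dy e0.
split=> [wPQ|H]; last first.
  have {}H : (dy * (f Q - f P) = dx * (g Q - g P))%R.
    by apply/eqP; rewrite -subr_eq0; apply/eqP; rewrite -[RHS]oppr0 -H; ring.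
  have [d0|nzd] := eqVneq dx 0%R.
    have nzy : dy != 0%R.
      apply: contraNneq nQ0 => e0; apply/eqP/fg_inj; apply/eqP.
        by rewrite -subr_eq0 -/dx d0.
      by rewrite -subr_eq0 -/dy e0.
    have e0 : (f Q - f P = 0)%R.
      by apply: (mulfI nzy); rewrite H d0 mul0r mulr0.
    apply: (multiple ((g Q - g P) / dy : 'F_p)%R); rewrite natF ?divfK //.
      by rewrite d0 mulr0 addr0; apply/eqP; rewrite -subr_eq0 e0.
    by ring.
  apply: (multiple ((f Q - f P) / dx : 'F_p)%R); rewrite natF ?divfK //.
    by ring.
  by rewrite mulrAC -[((_ - _) * dy)%R]mulrC H mulrAC divff // mul1r; ring.
have [ewx|nwx] := eqVneq w x.
  rewrite ewx in wPQ wQ0; move/fP: wPQ => ->; move/fP: wQ0 => e0.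
  by rewrite /dx e0; ring.
have nzd : dx != 0%R.
  rewrite subr_eq0; apply: contraNneq nQ0 => e0.
  by apply/eqP/(cross_uniq nwx); [|apply/fP].
pose k : 'F_p := ((f Q - f P) / dx)%R.
(* [S] is on the w-line of [P] and on the x-line of [Q], as is [Q], so the two coincide. *)
have [S [S1 S2]] := onto' (f Q) (g P + dy *+ k)%R.
have eSQ : S = Q.
  apply: (cross_uniq nwx); last by apply/fP.
  rewrite -wPQ; apply/esym/(multiple k); last exact: S2.
  by rewrite S1 natF divfK //; ring.
rewrite -eSQ S1 S2 natF.
have {1}-> : f Q = (f P + k * dx)%R by rewrite divfK //; ring.
by ring.
Qed.

End AffinePlane.

(** * The affine plane off a line *)

Section AtInfinity.
Variables (X : incidence_system) (n : nat).
Hypotheses (plX : projective_plane X) (ordX : has_order X n).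
Variable (h : {set point X}).
Hypothesis (lh : h \in lines X).

Definition affine_point : finType := {P : point X | P \notin h}.
Definition infinite_point : finType := {c : point X | c \in h}.
Implicit Types (P Q R : affine_point) (c d : infinite_point).

Definition through c P : {set point X} :=
  odflt set0 [pick l in lines X | (val c \in l) && (val P \in l)].

Lemma infinite_neq c P : val c != val P.
Proof. by apply/eqP=> e; case/negP: (valP P); rewrite -e (valP c). Qed.

Lemma throughP c P : [/\ through c P \in lines X, val c \in through c P & val P \in through c P].
Proof.
rewrite /through; case: pickP => [l /and3P[] //|H].
have [l ll lcP] := join_exists plX (infinite_neq c P).
by have := H l; rewrite ll lcP.
Qed.

Lemma through_line c P : through c P \in lines X. Proof. by case: (throughP c P). Qed.

Lemma throughE c P l : l \in lines X -> val c \in l -> val P \in l -> through c P = l.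
Proof.
have [lk ck Pk] := throughP c P => ll cl Pl.
exact: (line_eq plX lk ll (infinite_neq c P)).
Qed.

Lemma mem_through c P Q : (val Q \in through c P) = (through c P == through c Q).
Proof.
have [lP cP PP] := throughP c P; have [lQ cQ QQ] := throughP c Q.
apply/idP/eqP => [QP|->//]; exact/esym/throughE.
Qed.

(** A line with an affine point meets [h] in one point only. *)
Lemma mem_through_infinite c d P : (val d \in through c P) = (d == c).
Proof.
have [lP cP PP] := throughP c P; apply/idP/eqP => [dP|-> //].
apply/eqP; rewrite -val_eqE; apply/negPn/negP=> ndc; case/negP: (valP P).
have eh := line_eq plX lh lP ndc (valP d) (valP c) dP cP.
by move: PP; rewrite -[in X in X -> _]eh.
Qed.

Lemma through_cross_exists c d P Q : c != d ->
  exists R, through c R = through c P /\ through d R = through d Q.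
Proof.
move=> ncd; have [lP cP PP] := throughP c P; have [lQ dQ QQ] := throughP d Q.
have [x xP xQ] := meet_exists plX lP lQ.
have xh : x \notin h.
  apply: contra ncd => xh; pose e : infinite_point := exist _ x xh.
  have := mem_through_infinite c e P; rewrite xP => /esym/eqP <-.
  by have := mem_through_infinite d e Q; rewrite xQ => /esym.
exists (exist _ x xh : affine_point); split; apply/esym/eqP.
  by rewrite -mem_through.
by rewrite -mem_through.
Qed.

Lemma through_cross_uniq c d P Q : c != d ->
  through c P = through c Q -> through d P = through d Q -> P = Q.
Proof.
move=> ncd cPQ dPQ; have [lP cP PP] := throughP c P; have [lQ dP PQ] := throughP d P.
have nl : through c P != through d P.
  by apply: contra ncd => /eqP e; rewrite -(mem_through_infinite d c P) -e.
apply/val_inj/(point_eq plX lP lQ nl) => //; rewrite mem_through ?cPQ ?dPQ //.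
Qed.

Lemma card_through_affine c P : #|[set Q | through c Q == through c P]| = n.
Proof.
have [lP cP PP] := throughP c P.
rewrite -(card_imset _ val_inj); have := cardsD1 (val c) (through c P).
rewrite cP (card_line ordX lP) add1n => -[->]; apply: eq_card => x.
apply/imsetP/idP => [[Q]|].
  rewrite inE => /eqP cQP ->; rewrite !inE mem_through cQP eqxx andbT eq_sym.
  exact: infinite_neq.
rewrite !inE => /andP[nxc xP]; have xh : x \notin h.
  apply: contra nxc => xh; pose e : infinite_point := exist _ x xh.
  by have := mem_through_infinite c e P; rewrite xP => /esym/eqP <-.
by exists (exist _ x xh : affine_point); rewrite // inE eq_sym -mem_through.
Qed.

Hypothesis papX : pappian X.

Lemma uniq_vals (P Q R : point X) : P != Q -> P != R -> Q != R -> uniq [:: P; Q; R].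
Proof. by move=> nPQ nPR nQR; rewrite /= !inE negb_or nPQ nPR nQR. Qed.

Lemma pappian_thomsen x y z : uniq [:: x; y; z] -> thomsen through x y z.
Proof.
rewrite /= !inE !negb_or -!andbA => /and4P[nxy nxz nyz _].
move=> Q1 Q2 Q3 Q4 Q5 Q6 x12 x45 y25 y16 y34 z14 z23 z56.
have xy := through_cross_uniq nxy; have xz := through_cross_uniq nxz.
have yz := through_cross_uniq nyz.
(* If two of the three y-lines coincide, the six points coincide in pairs and the conclusion is
   immediate. *)
have [y12|ny12] := eqVneq (through y Q1) (through y Q2).
  have e56 : Q5 = Q6 by apply: yz; congruence.
  have e12 : Q1 = Q2 by apply: xy; congruence.
  have e34 : Q3 = Q4 by apply: yz; congruence.
  congruence.
have [y13|ny13] := eqVneq (through y Q1) (through y Q3).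
  have e14 : Q1 = Q4 by apply: yz; congruence.
  have e25 : Q2 = Q5 by apply: xy; congruence.
  have e36 : Q3 = Q6 by apply: yz; congruence.
  congruence.
have [y23|ny23] := eqVneq (through y Q2) (through y Q3).
  have e23 : Q2 = Q3 by apply: yz; congruence.
  have e45 : Q4 = Q5 by apply: xy; congruence.
  have e16 : Q1 = Q6 by apply: yz; congruence.
  congruence.
have n13 : through x Q1 != through x Q3.
  by apply: contraNneq ny23 => e; have {}e : through x Q1 = through x Q3 := e;
    rewrite (xz Q2 Q3) //; congruence.
have n14 : through x Q1 != through x Q4.
  by apply: contraNneq ny13 => e; have {}e : through x Q1 = through x Q4 := e;
    rewrite (xz Q1 Q4) ?y34 //; congruence.
(* The triples are x, Q1, Q2 and y, Q3, Q4. Two of the cross-intersections are z and Q5, so the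
   third is on the z-line of Q5; being on the y-line of Q1 too, it is Q6. *)
have [||||||||||| C3 /and3P[C3n C3a12 C3a21]] := @papX
  (through x Q1) (through y Q3) (through z Q5) (through x Q3) (through y Q1)
  (through x Q4) (through y Q2) (through z Q1) (through z Q2)
  (val x) (val Q1) (val Q2) (val y) (val Q3) (val Q4) (val z) (val Q5).
- by rewrite /= !through_line.
- by rewrite mem_through_infinite !mem_through x12 !eqxx.
- by rewrite mem_through_infinite !mem_through y34 !eqxx.
- by rewrite !mem_through_infinite !mem_through !eqxx.
- by rewrite !mem_through_infinite !mem_through z14 z23 !eqxx.
- by rewrite !mem_through_infinite !eqxx.
- by rewrite !mem_through x45 y25 !eqxx.
- by rewrite mem_through_infinite !mem_through nxy eq_sym ny13 eq_sym ny23.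
- by rewrite mem_through_infinite !mem_through eq_sym nxy n13.
- apply: uniq_vals; rewrite ?infinite_neq // val_eqE.
  by apply: contraNneq ny12 => ->.
- apply: uniq_vals; rewrite ?infinite_neq // val_eqE.
  apply: contraNneq ny12 => e; have {}e : Q3 = Q4 := e;
    rewrite (xz Q1 Q2) //; congruence.
have eC3 : C3 = val Q6.
  apply: (point_eq plX (through_line z Q6) (through_line y Q6)).
  - by apply: contra nyz => /eqP e; rewrite -(mem_through_infinite z y Q6) e mem_through_infinite.
  - by rewrite -z56.
  - by rewrite -y16.
  - by rewrite mem_through.
  - by rewrite mem_through.
by apply/eqP; rewrite -mem_through -eC3.
Qed.

Lemma pappian_hexagon y x z w : uniq [:: y; x; z; w] -> hexagon through y x z w.
Proof.
rewrite /= !inE !negb_or -!andbA.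
move=> /and5P[nyx nyz nyw nxz /and3P[nxw nzw _]].
move=> P C E Q B D yPC yPE yQB yQD xQC xED zCB zDP wPQ.
have yx := through_cross_uniq nyx; have yz := through_cross_uniq nyz.
have yw := through_cross_uniq nyw; have xz := through_cross_uniq nxz.
have xw := through_cross_uniq nxw; have zw := through_cross_uniq nzw.
(* If the two parallel lines coincide, all six points are equal. *)
have [yPQ|nyPQ] := eqVneq (through y P) (through y Q).
  have ePQ : P = Q by apply: yw; congruence.
  have eCQ : C = Q by apply: yx; congruence.
  have eBC : B = C by apply: yz; congruence.
  have eDP : D = P by apply: yz; congruence.
  have eED : E = D by apply: yx; congruence.
  congruence.
have nPC : P != C.
  by apply: contraNneq nyPQ => e; have {}e : P = C := e; rewrite (xw P Q) //; congruence.
have nPE : P != E.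
  by apply: contraNneq nyPQ => e; have {}e : P = E := e; rewrite yQD (xz P D) //; congruence.
have nQD : Q != D.
  by apply: contraNneq nyPQ => e; have {}e : Q = D := e; rewrite (zw P Q) //; congruence.
have nEC : E != C.
  by apply: contraNneq nQD => e; have {}e : E = C := e; apply/eqP/yx; congruence.
have nBQ : B != Q.
  by apply: contraNneq nyPQ => e; have {}e : B = Q := e; rewrite yPC (xz C Q) //; congruence.
have nBD : B != D.
  by apply: contraNneq nPC => e; have {}e : B = D := e; apply/eqP/yz; congruence.
have nEB : val E != val B.
  by rewrite val_eqE; apply: contraNneq nyPQ => e; rewrite yPE e yQB.
have [k lk /andP[Ek Bk]] := join_exists plX nEB.
(* The triples are P, E, C and B, Q, D. The lines PQ and EB then meet on [h], and PQ meets [h] in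
   w. *)
have [||||||||||| C3 /and3P[C3n C3a12 C3a21]] := @papX
  (through y P) (through y Q) h (through w P) k (through z P) (through z C)
  (through x E) (through x C)
  (val P) (val E) (val C) (val B) (val Q) (val D) (val x) (val z).
- by rewrite /= !through_line lh lk.
- by rewrite !mem_through -yPC -yPE !eqxx.
- by rewrite !mem_through -yQB -yQD !eqxx.
- by rewrite !mem_through Ek !eqxx.
- by rewrite !mem_through Bk wPQ zCB zDP xQC xED !eqxx.
- by rewrite !mem_through_infinite !eqxx (valP x).
- by rewrite !mem_through_infinite !eqxx (valP z).
- by rewrite !mem_through -yPC -yPE eq_sym nyPQ.
- by rewrite !mem_through -yQB -yQD nyPQ.
- by apply: uniq_vals; rewrite val_eqE.
- by apply: uniq_vals; rewrite val_eqE.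
pose e : infinite_point := exist _ C3 C3n.
have := mem_through_infinite w e P; rewrite C3a12 => /esym/eqP ew.
have wk : val w \in k by rewrite -ew.
by rewrite (throughE lk) // (throughE lk).
Qed.

End AtInfinity.

(** * Pappian planes of prime order *)

(** The image of a line lies in a line of the same size, so it is that line; every line of [Y]
    arises by joining the preimages of two of its points. *)
Lemma lineation_isomorphic (X Y : incidence_system) n (phi : point X -> point Y) :
  projective_plane X -> has_order X n -> projective_plane Y -> has_order Y n ->
  injective phi -> #|point X| = #|point Y| ->
  (forall l, l \in lines X -> exists2 m, m \in lines Y & phi @: l \subset m) ->
  isomorphic X Y.
Proof.
move=> plX ordX plY ordY phi_inj cardXY phiP.
have phi_bij : bijective phi.
  by apply: inj_card_bij => //; rewrite cardXY.
have phi_line l : l \in lines X -> phi @: l \in lines Y.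
  move=> ll; have [m lm sub] := phiP _ ll; suff -> : phi @: l = m by [].
  apply/eqP; rewrite eqEcard sub (card_imset _ phi_inj) (card_line ordX ll).
  by rewrite (card_line ordY lm) leqnn.
pose g (l : {l : {set point X} | l \in lines X}) : {l : {set point Y} | l \in lines Y} :=
  exist _ (phi @: val l) (phi_line _ (valP l)).
exists phi, g; split=> // [|x l]; last first.
  by split=> [xl|/imsetP[x' x'l /phi_inj ->]] //; apply: imset_f.
have g_inj : injective g.
  by move=> l m /(congr1 val) /= /(imset_inj phi_inj) /val_inj.
have [psi phiK psiK] := phi_bij.
have g_onto m : exists l, g l == m.
  have [H2 _] := plY; have /card_gt1P[y [z [ym zm nyz]]] := proj1 H2 _ (valP m).
  have nxz : psi y != psi z by apply: contraNneq nyz => /(can_inj psiK) ->.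
  have [l ll /andP[yl zl]] := join_exists plX nxz.
  exists (exist _ l ll : {l : {set point X} | l \in lines X}).
  apply/eqP/val_inj/(line_eq plY (phi_line _ ll) (valP m) nyz) => //.
    by rewrite -[y]psiK imset_f.
  by rewrite -[z]psiK imset_f.
by exists (fun m => xchoose (g_onto m)) => [l|m];
  [apply: g_inj; apply/eqP/(xchooseP (g_onto (g l))) | apply/eqP/(xchooseP (g_onto m))].
Qed.

Section Vec3.
Variable F : finFieldType.
Local Open Scope ring_scope.

Definition vec3 (a b c : F) : 'rV[F]_3 := \row_i [:: a; b; c]`_i.

Lemma vec3_inj a b c a' b' c' : vec3 a b c = vec3 a' b' c' -> [/\ a = a', b = b' & c = c'].
Proof.
move=> /rowP e; split.
- by have := e (Ordinal (isT : (0 < 3)%N)); rewrite !mxE.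
- by have := e (Ordinal (isT : (1 < 3)%N)); rewrite !mxE.
- by have := e (Ordinal (isT : (2 < 3)%N)); rewrite !mxE.
Qed.

Lemma vec3_comb k a b c a' b' c' :
  vec3 a b c + k *: vec3 a' b' c' = vec3 (a + k * a') (b + k * b') (c + k * c').
Proof. by apply/rowP=> i; rewrite !mxE; case: i => -[|[|[|]]]. Qed.

Lemma vec30 : vec3 0 0 0 = 0.
Proof. by apply/rowP=> i; rewrite !mxE; case: i => -[|[|[|]]]. Qed.

Lemma vec3Z k a b c : k *: vec3 a b c = vec3 (k * a) (k * b) (k * c).
Proof. by rewrite -[LHS]add0r -vec30 vec3_comb !add0r. Qed.

End Vec3.

Lemma pappian_isomorphic p (X : incidence_system) :
  prime p -> projective_plane X -> has_order X p -> pappian X ->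
  #|point X| = #|point (PG2 'F_p)| -> 0 < #|point X| ->
  isomorphic X (PG2 'F_p).
Proof.
move=> p_pr plX ordX papX cardX /card_gt0P[x0 _].
have [h lh _] := avoid_exists plX x0.
have /card_gt2P[x [y [z [[xh yh zh] [nxy nyz nzx]]]]] : 2 < #|h|.
  by rewrite (card_line ordX lh); case: ordX.
pose A := affine_point h; pose I := infinite_point h.
have [O _] : exists O : A, true.
  have [[H2 _] _ H3] := plX; have [k lk xk] := avoid_exists plX x.
  have nhk : h != k by apply: contraNneq xk => <-.
  by have [O [Oh Ok]] := H3 h k lh lk nhk; exists (exist _ O Oh).
pose x' : I := exist _ x xh; pose y' : I := exist _ y yh; pose z' : I := exist _ z zh.
have uxyz : uniq [:: x'; y'; z'].
  by rewrite /= !inE negb_or -!val_eqE /= nxy nyz eq_sym nzx.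
have [f [g [onto fg_inj lineP]]] := affine_coordinates p_pr
  (through_cross_exists plX lh) (through_cross_uniq plX lh) (card_through_affine plX ordX lh)
  O uxyz (pappian_thomsen plX lh papX uxyz) (pappian_hexagon plX lh papX).
have /fin_all_exists[u /fin_all_exists[v uv]] := lineP.
(* Homogeneous coordinates: (v, -u) is the direction of the lines on which u f + v g is constant. *)
pose dir c := vec3 (v c) (- u c)%R 0%R.
pose aff P := vec3 (f P) (g P) 1%R.
pose vec (P : point X) : 'rV['F_p]_3 :=
  if insub P is Some Q then aff Q else if insub P is Some c then dir c else 0%R.
have vec_aff Q : vec (val Q) = aff Q by rewrite /vec valK.
have vec_dir c : vec (val c) = dir c.
  by rewrite /vec valK; case: insubP => [Q nh _|//]; case/negP: nh; apply: (valP c).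
have split_point (P : point X) :
    (exists Q : A, P = val Q) \/ (exists c : I, P = val c).
  have [Ph|nPh] := boolP (P \in h); [right | left].
    by exists (exist _ P Ph).
  by exists (exist _ P nPh).
have nz_dir c : dir c != 0%R.
  apply/eqP; rewrite -vec30 => /vec3_inj[v0 /eqP u0 _]; case: (uv c) => nz _.
  by apply: nz; rewrite v0; move: u0; rewrite oppr_eq0 => /eqP ->.
have nz_aff Q : aff Q != 0%R.
  by apply/eqP; rewrite -vec30 => /vec3_inj[_ _ /eqP]; rewrite oner_eq0.
have nz_vec P : vec P != 0%R.
  by case: (split_point P) => -[Q ->]; rewrite ?vec_aff ?vec_dir.
have /fin_all_exists[phi phiE] (P : point X) : exists Q : PG2_point 'F_p, val Q = <[vec P]>%VS.
  exact: PG2_pointP.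
apply: (@lineation_isomorphic X (PG2 'F_p) p phi) => //.
- exact: PG2_projective_plane.
- by have := PG2_has_order 'F_p; rewrite card_Fp.
- move=> P Q ePQ; have {ePQ} : vec P \in <[vec Q]>%VS by rewrite -phiE -ePQ phiE memv_line.
  case/vlineP=> k; case: (split_point P) => -[{}P ->]; case: (split_point Q) => -[{}Q ->];
    rewrite ?vec_aff ?vec_dir /aff /dir vec3Z => /vec3_inj[e1 e2 e3].
  + rewrite mulr1 in e3; congr val; apply: fg_inj.
      by rewrite e1 -e3 mul1r.
    by rewrite e2 -e3 mul1r.
  + by move/eqP: e3; rewrite mulr0 oner_eq0.
  + move: e1 e2; rewrite mulr1 in e3; rewrite -e3 !mul0r => e1 e2.
    by case/eqP: (nz_dir P); rewrite /dir e1 e2 vec30.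
  (* Two points at infinity with proportional directions have the same affine lines, so a second
     point [R] on the line from [P] to [O] would also be on the line from [Q] to [O]. *)
  congr val; apply/eqP/negPn/negP => nPQ.
  have [R nRO ePR] := other_exists p_pr (card_through_affine plX ordX lh) P O.
  case/eqP: nRO; apply: (through_cross_uniq plX lh nPQ) => //.
  have [_ H] := uv Q; apply/H; have [_ /(_ R O)[/(_ ePR) + _]] := uv P.
  have nzk : k != 0%R.
    apply: contraNneq (nz_dir P) => k0; apply/eqP.
    by rewrite /dir e1 e2 k0 !mul0r vec30.
  have -> : u P = (k * u Q)%R by rewrite -[u P]opprK e2 mulrN opprK.
  rewrite e1 => E; apply: (mulfI nzk); rewrite mulr0 -E; ring.
(* The line [h] goes to the plane of vectors with last coordinate 0; any other line goes to the
   plane spanned by its point at infinity and one affine point. *)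
move=> l ll; have [->|nlh] := eqVneq l h.
  pose e1 := (@vec3 'F_p 1 0 0)%R; pose e2 := (@vec3 'F_p 0 1 0)%R.
  pose W := (<[e1]> + <[e2]>)%VS.
  exists (PG2_line W).
    apply/PG2_lineP; exists W => //; apply: dim_plane.
      by apply/eqP; rewrite -vec30 => /vec3_inj[/eqP]; rewrite oner_eq0.
    apply/vlineP=> -[k]; rewrite vec3Z => /vec3_inj[_ /eqP].
    by rewrite mulr0 oner_eq0.
  apply/subsetP=> _ /imsetP[P Ph ->]; rewrite (mem_PG2_line _ (phiE P)).
  pose c : I := exist _ P Ph; rewrite -[P]/(val c) vec_dir.
  have -> : dir c = (v c *: e1 - u c *: e2)%R.
    by rewrite -scaleNr vec3Z vec3_comb; congr vec3; ring.
  by rewrite memv_add ?memvZ ?memv_line // -scaleNr memvZ ?memv_line.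
have [c0 c0l c0h] := meet_exists plX ll lh.
pose c : I := exist _ c0 c0h.
have [P0 P0l nP0] := second_point plX c0 ll.
have P0h : P0 \notin h.
  by apply: contra nlh => P0h; rewrite (line_eq plX ll lh nP0).
pose P : A := exist _ P0 P0h.
have el : through c P = l by apply: (throughE plX).
pose W := (<[dir c]> + <[aff P]>)%VS.
exists (PG2_line W).
  apply/PG2_lineP; exists W => //; apply: dim_plane => //.
  apply/vlineP=> -[k]; rewrite vec3Z => /vec3_inj[_ _ /eqP].
  by rewrite mulr0 oner_eq0.
apply/subsetP=> _ /imsetP[Q0 Q0l ->]; rewrite (mem_PG2_line _ (phiE Q0)).
case: (split_point Q0) => -[Q eQ]; rewrite eQ in Q0l *.
  rewrite vec_aff; have : through c Q = through c P.
    by apply/esym/eqP; rewrite -(mem_through plX) el.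
  have [nz /(_ Q P)[H _]] := uv c; move/H => {}H.
  (* The equation of the line makes the difference of the two affine points a multiple of its
     direction; the scalar is read off from a nonzero coordinate of [dir c]. *)
  have [k kE] : exists k, aff Q = (aff P + k *: dir c)%R.
    have E : (v c * (g Q - g P) = - (u c * (f Q - f P)))%R.
      by apply/eqP; rewrite -addr_eq0 addrC H.
    rewrite /aff /dir; have [v0|nzv] := eqVneq (v c) 0%R.
      have nzu : u c != 0%R by apply/eqP=> u0; apply: nz; rewrite u0 v0.
      exists ((g P - g Q) / u c)%R; rewrite vec3_comb mulr0 addr0 v0 mulr0 addr0.
      congr vec3; last by rewrite mulrN divfK //; ring.
      apply/eqP; rewrite -subr_eq0; apply/eqP/(mulfI nzu).
      by rewrite mulr0 -[LHS]opprK -E v0 mul0r oppr0.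
    exists ((f Q - f P) / v c)%R; rewrite vec3_comb mulr0 addr0 divfK //.
    congr vec3; first by ring.
    apply/eqP; rewrite addrC -subr_eq; apply/eqP/(mulfI nzv); rewrite E.
    by field.
  by rewrite kE addrC memv_add ?memvZ ?memv_line.
rewrite vec_dir; have -> : Q = c.
  by apply/eqP; rewrite -(mem_through_infinite plX lh c Q P) el.
by rewrite -[dir c]addr0 memv_add ?memv_line ?mem0v.
Qed.

Theorem theorem4p5 (p : nat) (X : incidence_system) :
  prime p ->
  projective_plane X ->
  has_order X p ->
  complete_weight_enumerator (code p X)
    = complete_weight_enumerator (code p (PG2 'F_p)) ->
  2 ^ 9 < p ->
  isomorphic X (PG2 'F_p).
Proof.
move=> p_pr plX ordX cwe lt29p.
have plY := PG2_projective_plane 'F_p.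
have ordY : has_order (PG2 'F_p) p.
  by have := PG2_has_order 'F_p; rewrite card_Fp.
have types := cwe_types cwe.
(* The entries of a type add up to the number of points; the zero word supplies a type common to
   both codes. *)
have cardX : #|point X| = #|point (PG2 'F_p)|.
  have [w _ tw] := types 0%R (mem0v _).
  have := sum_word_type w (fun=> 1); rewrite tw -sum_word_type.
  by rewrite !sum1_card.
have cardX_gt0 : 0 < #|point X|.
  have [|a a0] := @exists_notin 'F_p 0%VS; first by rewrite dimv0.
  have [|x _] := @PG2_pointP 'F_p a; first by rewrite -memv0.
  by rewrite cardX; apply/card_gt0P; exists x.
apply: pappian_isomorphic => //.
by apply: (pappian_transfer p_pr plX ordX plY ordY types (ltnW lt29p)); apply: PG2_pappian.
Qed.
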